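(* Let $K$ be a number field of degree $d$ with signature $(r_1,r_2)$ and absolute discriminant $\Delta$. Let $\mathfrak{A}$ be a nonzero integral ideal of $\mathcal{O}_K$ and let \[ c(\mathfrak{A},K)=\max\left(\left(\tfrac{2}{\pi}\right)^{r_2}\sqrt{|\Delta|}\,\mathcal{N}(\mathfrak{A}),\,1\right). \] Then for every rational integer $M>c(\mathfrak{A},K)$ there exists a real number $\epsilon=\epsilon(\mathfrak{A})$ with $0<\epsilon<1$ such that for each $\xi\in K$ there exist $\tau\in\mathfrak{A}$ and a rational integer $0<j<M$ with $|\sigma(j\xi-\tau)|<\epsilon$ for every embedding $\sigma$ of $K$ into $\mathbb{C}$. In particular $|N_{K/\mathbb{Q}}(j\xi-\tau)|<\epsilon^d$.
   Context: $\mathcal{N}(\mathfrak{A})=|\mathcal{O}_K/\mathfrak{A}|$ is the ideal norm; $|\cdot|$ is the complex absolute value. *)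

(* Defs.v *)
From HB Require Import structures.
From mathcomp Require Export all_boot all_order all_algebra all_field.
From mathcomp Require Export finmap complex.
From mathcomp Require Export boolp classical_sets functions cardinality reals.
From mathcomp Require Export topology normedtype trigo.

Set Implicit Arguments.
Unset Strict Implicit.
Unset Printing Implicit Defensive.

Import Order.TTheory GRing.Theory Num.Theory.
Local Open Scope classical_set_scope.
Local Open Scope ring_scope.

(* A number field is a K : fieldExtType rat; its degree is \dim {:K}. *)

Section NumberField.
Variable K : fieldExtType rat.

Definition ring_of_integers : set K :=
  [set x | integralOver (intr : int -> K) x].

Definition integral_ideal (A : set K) : Prop :=
  [/\ A `<=` ring_of_integers, A 0,
      forall x y, A x -> A y -> A (x + y) &
      forall a x, ring_of_integers a -> A x -> A (a * x)].

Definition ideal_coset (A : set K) (x : K) : set K := [set y | A (y - x)].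

(* Equal to 0 if O_K / A is infinite, which does not happen for A nonzero. *)
Definition ideal_norm (A : set K) : nat :=
  #|` fset_set (ideal_coset A @` ring_of_integers)|%fset.

Definition mul_mx (x : K) : 'M[rat]_(\dim {:K}) :=
  passmx.mxof (vbasis {:K}) (vbasis {:K}) (amull x).

Definition field_norm (x : K) : rat := \det (mul_mx x).

Definition field_trace (x : K) : rat := \tr (mul_mx x).

Definition is_integral_basis (w : (\dim {:K}).-tuple K) : Prop :=
  basis_of {:K} w /\
  ring_of_integers =
    [set x | exists a : 'I_(\dim {:K}) -> int, x = \sum_(i < \dim {:K}) w`_i *~ a i].

(* The default value vbasis {:K} of xget is never used: an integral basis
   always exists. *)
Definition integral_basis : (\dim {:K}).-tuple K :=
  xget (vbasis {:K}) is_integral_basis.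

Definition discriminant : rat :=
  \det (\matrix_(i, j < \dim {:K})
          field_trace (integral_basis`_i * integral_basis`_j)).

Section Signature.
Variable R : realType.

(* The field embeddings as plain functions; a morphism of fields is injective
   and fixes the rationals. *)
Definition embeddings : set (K -> R[i]) :=
  [set f : K -> R[i] | exists s : {rmorphism K -> R[i]}, f = s :> (K -> R[i])].

Definition is_real_embedding (f : K -> R[i]) : Prop :=
  forall x, complex.Im (f x) = 0.

Definition r1 : nat := #|` fset_set (embeddings `&` is_real_embedding)|%fset.

(* Non-real embeddings come in pairs of complex conjugates. *)
Definition r2 : nat :=
  #|` fset_set (embeddings `\` is_real_embedding)|%fset./2.

Definition c_const (A : set K) : R :=
  Num.max ((2 / pi) ^+ r2 * Num.sqrt `|ratr discriminant| * (ideal_norm A)%:R)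
          1.

End Signature.
End NumberField.

(* Main.v *)
(* Minkowski's pigeonhole argument, discretised so that no measure theory is
   needed. Let M > c(A, K). In Minkowski space the M translates of a polydisc of
   radius slightly below 1/2 by the points j xi have total volume larger than the
   covolume 2^-r2 sqrt|Delta| N(A) of A, so two of them meet modulo A. They cannot
   be translates by the same j, since then a nonzero element of A would have all
   its conjugates of absolute value less than 1, hence norm less than 1.
   To count instead of integrate, rescale by t = k L, with k > 2 fixed and L a
   large integer, and round everything to integers. The lattice of O_K becomes
   T Z^d with T an integer matrix, so that Z^d / T Z^d has |det T| classes; the
   polydisc becomes a product of integer intervals [-L, L] and of integer discs of
   radius L, the latter having at least pi L^2 - 4 L - 1 points. Coincidence of the
   classes in both Z^d / T Z^d and O_K / A gives tau, and the rounding errors are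
   bounded independently of L and xi. *)
From HB Require Import structures.
Require Import Defs.
From mathcomp Require Import perm derive sequences ring lra zify.
Set Implicit Arguments.
Unset Strict Implicit.
Unset Printing Implicit Defensive.
Import Order.TTheory GRing.Theory Num.Theory.
Import numFieldNormedType.Exports.
Local Open Scope classical_set_scope.
Local Open Scope ring_scope.
Local Open Scope complex_scope.

(** * Lattice points in a disc *)

(* [z - sin z cos z] is twice the area under the unit circle from [cos z] to 1: a
   Riemann sum bound that uses derivatives only, no integral. *)
Lemma segment_area_le (R : realType) (x y : R) : 0 <= x -> x <= y -> y <= pi / 2 ->
  (y - sin y * cos y) - (x - sin x * cos x) <= 2 * sin y * (cos x - cos y).
Proof.
move=> x0 xy yp.
(* The claim is [f y <= f x]. The derivative [df] is nonpositive on [[x, y]], because sine is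
   nonnegative and increasing on [[0, pi/2]]. *)
pose f : R -> R := (2 * sin y) *: (@cos R) + (id - (@sin R) * (@cos R)).
pose df (z : R) : R := 2 * sin z * (sin z - sin y).
have dfP (z : R) : is_derive z (1 : R) f (df z).
  have /is_derive_eq := is_deriveD (is_deriveZ (2 * sin y) (is_derive_cos z))
    (is_deriveB (is_derive_id z (1 : R)) (is_deriveM (is_derive_sin z) (is_derive_cos z))).
  apply; have c2 : cos z ^+ 2 = 1 - sin z ^+ 2 by rewrite -(cos2Dsin2 z) addrK.
  rewrite /df /= /GRing.scale /= -[cos z * cos z]expr2 c2; ring.
have [|c] := @MVT_segment R f df x y xy.
  by apply: derivable_within_continuous => t _; case: (dfP t).
rewrite in_itv /= => /andP[xc cy] fE.
suff : f y - f x <= 0.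
  by rewrite /f /= !fctE /= /GRing.scale /=; lra.
rewrite fE; apply: mulr_le0_ge0; last by rewrite subr_ge0.
have pi0 : 0 < (pi : R) by exact: pi_gt0.
apply: mulr_ge0_le0.
  rewrite mulr_ge0 // sin_ge0_pi //; apply/andP; split; first exact: le_trans xc.
  by apply: (le_trans (le_trans cy yp)); lra.
rewrite subr_le0 leNgt ltr_sin -?leNgt // in_itv /=; apply/andP; split; lra.
Qed.

(** Cut the quarter of the unit disc at the abscissas [a / L = cos (th a)]. By [segment_area_le]
    each slice has at most the area of the rectangle with its left-hand height, and the slice areas
    telescope. *)
Lemma quarter_disc_riemann (R : realType) (L : nat) :
  pi / 4 * L%:R ^+ 2 <= \sum_(a < L) Num.sqrt (L%:R ^+ 2 - a%:R ^+ 2) :> R.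
Proof.
case: L => [|l]; first by rewrite big_ord0 expr0n mulr0.
set L := l.+1; have L0 : 0 < L%:R :> R by rewrite ltr0n.
pose th a : R := acos (a%:R / L%:R).
have hin a : (a <= L)%N -> (0 <= a%:R / L%:R :> R) /\ (a%:R / L%:R <= 1 :> R).
  by move=> aL; split; [rewrite divr_ge0|rewrite ler_pdivrMr // mul1r ler_nat].
have hin' a : (a <= L)%N -> a%:R / L%:R \in `[(-1 : R), 1].
  by move=> /hin[? ?]; rewrite in_itv /=; apply/andP; split; lra.
have hin'' a : (a <= L)%N -> -1 <= (a%:R / L%:R : R) <= 1.
  by move=> /hin[? ?]; apply/andP; split; lra.
have cth a : (a <= L)%N -> cos (th a) = a%:R / L%:R by move=> /hin' h; exact: acosK.
have sth a : (a <= L)%N -> sin (th a) = Num.sqrt (L%:R ^+ 2 - a%:R ^+ 2) / L%:R.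
  move=> aL; rewrite sin_acos ?hin'' //.
  have -> : (1 - (a%:R / L%:R) ^+ 2 : R) = (L%:R ^+ 2 - a%:R ^+ 2) * (L%:R^-1) ^+ 2.
    by field; rewrite lt0r_neq0.
  by rewrite sqrtrM ?sqrtr_sqr ?ger0_norm ?invr_ge0 // subr_ge0 ler_sqr ?nnegrE // ler_nat.
have thp a : (a <= L)%N -> th a \in `[0, pi].
  by move=> aL; rewrite in_itv /= acos_ge0 ?acos_lepi ?hin''.
have mth a : (a < L)%N -> th a.+1 <= th a.
  move=> aL; rewrite leNgt; apply/negP; rewrite -(ltr_cos (thp _ (ltnW aL)) (thp _ aL)).
  by rewrite !cth ?(ltnW aL) // ltr_pM2r ?invr_gt0 // ltr_nat ltnNge leqnSn.
have th0 : th 0%N = pi / 2 by rewrite /th mul0r acos0.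
have thL : th L = 0 by rewrite /th divff ?acos1 // lt0r_neq0.
have thle a : (a <= L)%N -> th a <= pi / 2.
  elim: a => [|a IH] aL; first by rewrite th0.
  exact: le_trans (mth _ aL) (IH (ltnW aL)).
pose H a := th a - sin (th a) * cos (th a).
(* The total is twice the area [pi / 4] of the quarter disc, since [H] doubles areas. *)
have tele : \sum_(a < L) (H a - H a.+1) = pi / 2.
  rewrite -(big_mkord xpredT (fun a => H a - H a.+1)).
  under eq_bigr do rewrite -opprB.
  rewrite sumrN telescope_sumr // opprB /H thL th0 sin0 cos_pihalf; lra.
have -> : pi / 4 * L%:R ^+ 2 = \sum_(a < L) ((H a - H a.+1) / 2 * L%:R ^+ 2) :> R.
  rewrite -!mulr_suml tele; lra.
apply: ler_sum => a _.
have aL := ltn_ord a.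
have := @segment_area_le R (th a.+1) (th a).
have := thp _ aL; rewrite in_itv /= => /andP[h0 _] /(_ h0 (mth _ aL) (thle _ (ltnW aL))).
rewrite -/(H a) -/(H a.+1) !cth ?(ltnW aL) // sth ?(ltnW aL) // => hle.
have -> : Num.sqrt (L%:R ^+ 2 - a%:R ^+ 2) =
  (2 * (Num.sqrt (L%:R ^+ 2 - a%:R ^+ 2) / L%:R) * (a.+1%:R / L%:R - a%:R / L%:R))
    / 2 * L%:R ^+ 2 :> R.
  by rewrite -[a.+1%:R]natr1; field; rewrite lt0r_neq0.
by rewrite ler_pM2r ?exprn_gt0 // ler_pM2r // invr_gt0.
Qed.

Definition centered (L : nat) (i : 'I_(2 * L).+1) : int := i%:Z - L%:Z.

Lemma centered_inj L : injective (@centered L).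
Proof. by move=> i j; rewrite /centered => /addIr [] /val_inj. Qed.

Lemma centered_le L (i : 'I_(2 * L).+1) : `|centered i| <= L%:Z.
Proof. by rewrite /centered; have := ltn_ord i; lia. Qed.

Definition int_disc (L : nat) : {set 'I_(2 * L).+1 * 'I_(2 * L).+1} :=
  [set p | centered p.1 ^+ 2 + centered p.2 ^+ 2 <= L%:Z ^+ 2]%SET.

(** With [k] the integer part of the half-chord [x], the row contains the [2k + 1] integers of
    [[-k, k]], and [k > x - 1]. *)
Lemma int_disc_row (R : realType) (L : nat) (i : 'I_(2 * L).+1) :
  2 * Num.sqrt (L%:R ^+ 2 - (centered i)%:~R ^+ 2) - 1 <=
  #|[set j | (i, j) \in int_disc L]%SET|%:R :> R.
Proof.
set a := centered i; set x : R := Num.sqrt _.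
have aL := centered_le i; rewrite -/a in aL.
have xx : x ^+ 2 = L%:R ^+ 2 - a%:~R ^+ 2.
  have : (a ^+ 2)%:~R <= (L%:Z ^+ 2)%:~R :> R by rewrite ler_int; nia.
  by rewrite !rmorphXn /= => h; rewrite sqr_sqrtr // subr_ge0.
have x0 : 0 <= x by exact: sqrtr_ge0.
pose k := Num.truncn x; have /andP[kx xk] := truncn_itv x0; rewrite -/k in kx xk.
have kR : (k%:R ^+ 2 : R) <= x ^+ 2 by rewrite ler_sqr ?nnegrE.
have kL : a ^+ 2 + k%:Z ^+ 2 <= L%:Z ^+ 2.
  rewrite -(ler_int R) rmorphD !rmorphXn /= -!pmulrn; move: kR; rewrite xx; lra.
have kL' : (k <= L)%N by nia.
have lt (m : 'I_(2 * k).+1) : (m + L - k < (2 * L).+1)%N.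
  by have := ltn_ord m; lia.
pose g (m : 'I_(2 * k).+1) : 'I_(2 * L).+1 := Ordinal (lt m).
have ginj : injective g.
  by move=> m m' /(congr1 val) /= h; apply: val_inj => /=; lia.
have : ((2 * k).+1 <= #|[set j | (i, j) \in int_disc L]%SET|)%N.
  rewrite -[X in (X <= _)%N]card_ord -cardsT -(card_imset _ ginj).
  apply: subset_leq_card; apply/fintype.subsetP => j /imsetP[m _ ->].
  rewrite !finset.inE /= -/a.
  have -> : centered (g m) = m%:Z - k%:Z by rewrite /centered /=; have := ltn_ord m; lia.
  have := ltn_ord m; nia.
rewrite -(ler_nat R) => h; apply: le_trans h.
rewrite -[(2 * k).+1%:R]natr1 natrM; move: xk; rewrite -natr1; lra.
Qed.

(** Sum over rows. Rounding costs 1 in each of the [2L + 1] rows; the remaining [2L] comes from the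
    central row, which the two half-discs share. *)
Lemma card_int_disc_ge (R : realType) (L : nat) :
  pi * L%:R ^+ 2 - 4 * L%:R - 1 <= #|int_disc L|%:R :> R.
Proof.
have -> : #|int_disc L| = (\sum_i #|[set j | (i, j) \in int_disc L]%SET|)%N.
  rewrite -sum1_card; under [in RHS]eq_bigr do rewrite -sum1_card.
  rewrite pair_big_dep /=; apply: eq_bigl => -[i j] /=.
  by rewrite !finset.inE.
rewrite natr_sum.
pose F (a : R) := Num.sqrt (L%:R ^+ 2 - a ^+ 2).
apply: (@le_trans _ _ (\sum_(i < (2 * L).+1) (2 * F (centered i)%:~R - 1))); last first.
  by apply: ler_sum => i _; exact: int_disc_row.
rewrite big_split /= sumr_const card_ord -mulr_sumr.
(* Doubling the half-sum counts the row 0 twice, hence the correction [F 0 = L]; the outermost rows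
   are bounded below by 0. *)
suff h : 2 * \sum_(a < L) F a%:R - L%:R <= \sum_(i < (2 * L).+1) F (centered i)%:~R.
  have := @quarter_disc_riemann R L; rewrite -/(F _) => h2.
  rewrite mulNrn -[(2 * L).+1%:R]natr1 natrM; lra.
have -> : \sum_(i < (2 * L).+1) F (centered i)%:~R =
   \sum_(0 <= i < (2 * L).+1) F (i%:R - L%:R).
  by rewrite big_mkord; apply: eq_bigr => i _; rewrite /centered rmorphB.
have Fsym a b : F (a - b) = F (b - a) by rewrite /F -[(a - b) ^+ 2]sqrrN opprB.
have F0 a : 0 <= F a by exact: sqrtr_ge0.
have FL : F 0 = L%:R by rewrite /F expr0n subr0 sqrtr_sqr ger0_norm.
rewrite (@big_cat_nat _ _ _ L) //=; last by lia.
rewrite [X in _ <= X + _]big_nat_rev /= add0n.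
have -> : \sum_(0 <= i < L) F ((L - i.+1)%:R - L%:R) = \sum_(0 <= i < L) F i.+1%:R.
  apply: eq_big_nat => i /andP[_ iL]; rewrite natrB // Fsym; congr F; lra.
have -> : \sum_(L <= i < (2 * L).+1) F (i%:R - L%:R) = \sum_(0 <= i < L.+1) F i%:R.
  rewrite -{1}(add0n L) big_addn; have -> : ((2 * L).+1 - L = L.+1)%N by lia.
  by apply: eq_bigr => i _; rewrite natrD addrK.
rewrite [X in _ <= _ + X]big_nat_recr //=.
have : \sum_(0 <= i < L.+1) F i%:R = F 0 + \sum_(0 <= i < L) F i.+1%:R.
  by rewrite big_nat_recl.
rewrite big_nat_recr //= FL -(big_mkord xpredT (fun a => F a%:R)).
by have := F0 L%:R; lra.
Qed.

(** * Classes modulo an integer matrix *)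

(** In Smith normal form [T = L D P], the class of [z] is given by the residues of the entries of
    [L^-1 z] modulo the diagonal entries of [D], whose product is [|det T|] up to sign. *)
Lemma int_mx_classes d (T : 'M[int]_d) : \det T != 0 ->
  exists cls : 'cV[int]_d -> 'I_`|\det T|,
    forall z z', cls z = cls z' -> exists u, z - z' = T *m u.
Proof.
move=> T0; have [L uL [P uP [e _ TE]]] := int_Smith_normal_form T.
set D := (X in T = L *m X *m P) in TE.
have unit1 (A : 'M[int]_d) : A \in unitmx -> `|\det A|%N = 1%N.
  by rewrite unitmxE qualifE /= => /orP[] /eqP ->.
pose f (i : 'I_d) : int := e`_i.
have DE : D = diag_mx (\row_i f i).
  by apply/matrixP => i j; rewrite !mxE.
have detT : `|\det T|%N = (\prod_(i < d) `|f i|)%N.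
  rewrite TE !det_mulmx !abszM. rewrite (unit1 L) // (unit1 P) // mul1n muln1 DE det_diag.
  rewrite (big_morph absz abszM (erefl : absz 1 = 1%N)).
  by apply: eq_bigr => i _; rewrite mxE.
have e0 (i : 'I_d) : (0 < `|f i|)%N.
  rewrite lt0n; apply/negP => /eqP ei0; case/negP: T0.
  by rewrite -absz_eq0 detT (bigD1 i) //= ei0.
pose X := {dffun forall i : 'I_d, 'I_`|f i|}.
have cX : #|{: X}| = `|\det T|%N.
  by rewrite card_dep_ffun foldrE big_map big_enum /= detT;
     apply: eq_bigr => i _; rewrite card_ord.
pose y (z : 'cV[int]_d) (i : 'I_d) : int := (invmx L *m z) i 0.
have rlt (z : 'cV[int]_d) (i : 'I_d) : (`|(y z i %% f i)%Z| < `|f i|)%N.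
  have ei0 : f i != 0 by rewrite -absz_gt0.
  have := ltz_mod (y z i) ei0; have := modz_ge0 (y z i) ei0; lia.
pose c z : X := [ffun i => Ordinal (rlt z i)].
exists (fun z => cast_ord cX (enum_rank (c z))) => z z' /cast_ord_inj /enum_rank_inj /ffunP cE.
have hq (i : 'I_d) : exists q, y z i - y z' i = f i * q.
  have := cE i; rewrite !ffunE => /(congr1 val) /= h.
  have ei0 : f i != 0 by rewrite -absz_gt0.
  have := modz_ge0 (y z i) ei0; have := modz_ge0 (y z' i) ei0.
  set r' := (_ %% _)%Z in h *; set r := (_ %% _)%Z in h * => r'0 r0.
  exists ((y z i %/ f i)%Z - (y z' i %/ f i)%Z).
  rewrite {1}(divz_eq (y z i) (f i)) {1}(divz_eq (y z' i) (f i)) -/r' -/r.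
  have -> : r = r' by lia.
  ring.
have [q qP] := fin_all_exists hq.
exists (invmx P *m \col_i q i).
have : L *m (D *m \col_i q i) = z - z'.
  have -> : D *m \col_i q i = invmx L *m z - invmx L *m z'.
    apply/matrixP => i j; rewrite DE mul_diag_mx ord1 mxE.
    rewrite [(\row__ _) _ _]mxE [(\col__ _) _ _]mxE -qP.
    by rewrite /y !mxE.
  by rewrite -mulmxBr mulmxA mulmxV // mul1mx.
by move=> <-; rewrite {1}TE -!mulmxA (mulmxA P) mulmxV // mul1mx.
Qed.

(** * Embeddings, norm and trace *)

Section Embeddings.
Variables (R : realType) (K : fieldExtType rat).
Local Notation C := R[i].
Local Notation d := (\dim {:K}).

Lemma map_alg_rmorph (s : {rmorphism K -> C}) (p : {poly rat}) :
  map_poly s (map_poly (in_alg K) p) = map_poly ratr p.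
Proof.
rewrite -map_poly_comp; apply: eq_map_poly => a /=.
by rewrite rmorphZ_num rmorph1 mulr1.
Qed.

Lemma rmorph_horner_alg (s : {rmorphism K -> C}) (t : K) (p : {poly rat}) :
  s (map_poly (in_alg K) p).[t] = (map_poly ratr p).[s t].
Proof. by rewrite -horner_map map_alg_rmorph. Qed.

(** Primitive element theorem in characteristic 0; [q] is the minimal polynomial of [t], brought
    down to rational coefficients. *)
Lemma number_field_generator : exists t : K, exists q : {poly rat},
  [/\ forall x : K, exists p, x = (map_poly (in_alg K) p).[t],
      size q = d.+1, separable_poly q, (map_poly (in_alg K) q).[t] = 0
    & forall p, (map_poly (in_alg K) p).[t] = 0 -> q %| p].
Proof.
pose t := separable_generator 1 {:K}; exists t.
have sepK : separable 1 {:K}.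
  apply/separableP => y _; apply: pcharf0_separable => p.
  by rewrite pchar_lalg pchar_num.
have Kt : ({:K} = <<1; t>>)%VS.
  by apply: eq_adjoin_separable_generator => //; exact: sub1v.
have /polyOver1P[q qE] := minPolyOver 1 t.
have dt : adjoin_degree 1 t = d.
  by have := dim_Fadjoin 1 t; rewrite -Kt dimv1 muln1.
exists q; split.
- move=> x; have : x \in <<1; t>>%VS by rewrite -Kt memvf.
  by case/Fadjoin_polyP => p /polyOver1P[p' ->] ->; exists p'.
- by have := size_minPoly 1 t; rewrite qE size_map_poly dt.
- rewrite -(separable_map (in_alg K)) -qE.
  by move/separableP: sepK => /(_ t (memvf _)).
- by rewrite -qE minPolyxx.
move=> p pt; rewrite -(dvdp_map (in_alg K)) -qE; apply: minPoly_dvdp.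
  by apply/polyOver1P; exists p.
exact/rootP.
Qed.

(** Embeddings correspond to the [d] distinct complex roots of [q], the possible images of [t].
    Invertibility of the matrix comes from a Vandermonde determinant. *)
Lemma exists_embeddings : exists s : 'I_d -> {rmorphism K -> C},
  (forall f : {rmorphism K -> C}, exists i, f =1 s i) /\
  (\matrix_(i, k) s i (vbasis {:K})`_k) \in unitmx.
Proof.
have [t [q [gen szq sepq qt dvq]]] := number_field_generator.
have [rs qE] := closed_field_poly_normal (map_poly ratr q : {poly C}).
have q0 : q != 0 by rewrite -size_poly_eq0 szq.
have lq0 : lead_coef (map_poly ratr q : {poly C}) != 0.
  by rewrite lead_coef_eq0 map_poly_eq0.
have szrs : size rs = d.
  have := size_map_poly (ratr : rat -> C) q.
  by rewrite qE size_scale // size_prod_XsubC szq => -[].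
have urs : uniq rs.
  rewrite -separable_prod_XsubC -(@eqp_separable _ (map_poly ratr q)).
    by rewrite separable_map.
  by rewrite qE; apply: eqp_scale.
have rsP z : (z \in rs) = root (map_poly ratr q) z.
  by rewrite qE rootZ // root_prod_XsubC.
have ext z : z \in rs -> exists s : {rmorphism K -> C}, s t = z.
  rewrite rsP => /rootP qz.
  have [P PE] := choice gen.
  (* Two polynomials with the same value at [t] differ by a multiple of [q], which vanishes at [z];
     so evaluation at [z] is well defined on [K]. *)
  have wd p p' : (map_poly (in_alg K) p).[t] = (map_poly (in_alg K) p').[t] ->
      (map_poly ratr p).[z] = (map_poly ratr p').[z].
    move=> pp'; apply/eqP; rewrite -subr_eq0 -hornerN -hornerD -rmorphB /=.
    have /dvdpP[u ->] : q %| p - p'.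
      by apply: dvq; rewrite rmorphB /= hornerD hornerN pp' subrr.
    by rewrite rmorphM /= hornerM qz mulr0.
  pose f x := (map_poly ratr (P x)).[z].
  have fE p : f (map_poly (in_alg K) p).[t] = (map_poly ratr p).[z].
    by apply: wd; rewrite -PE.
  have fB : zmod_morphism f.
    move=> x y; rewrite {1}(PE x) {1}(PE y) -hornerN -hornerD -rmorphB fE.
    by rewrite rmorphB /= hornerD hornerN.
  have fM : monoid_morphism f.
    split; last first.
      move=> x y; rewrite {1}(PE x) {1}(PE y) -hornerM -rmorphM fE.
      by rewrite rmorphM /= hornerM.
    have -> : 1 = (map_poly (in_alg K) 1).[t] by rewrite rmorph1 hornerC.
    by rewrite fE rmorph1 hornerC.
  pose s : {rmorphism K -> C} := HB.pack f
    (GRing.isZmodMorphism.Build K C f fB) (GRing.isMonoidMorphism.Build K C f fM).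
  exists s; rewrite /s /=.
  have -> : t = (map_poly (in_alg K) 'X).[t] by rewrite map_polyX hornerX.
  by rewrite fE map_polyX hornerX.
have nth_rs (i : 'I_d) : rs`_i \in rs by rewrite mem_nth // szrs.
have [s sE] := choice (fun i => ext _ (nth_rs i)).
exists s; split.
  move=> f; have ft : f t \in rs.
    by rewrite rsP; apply/rootP; rewrite -rmorph_horner_alg qt rmorph0.
  have ltd : (index (f t) rs < d)%N by rewrite -szrs index_mem.
  exists (Ordinal ltd) => x; have [p ->] := gen x.
  by rewrite !rmorph_horner_alg sE /= nth_index.
set E := \matrix_(i, k) _.
pose Y := \matrix_(j < d, k < d) (ratr (coord (vbasis {:K}) j (t ^+ k)) : C).
(* [Y] expresses the powers of [t] in the chosen basis, so the invertible Vandermonde matrix of the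
   roots factors through [E]. *)
have VE : (Vandermonde d (\row_i rs`_i))^T = E *m Y.
  apply/matrixP => i k; rewrite !mxE -sE -rmorphXn.
  rewrite {1}(coord_vbasis (memvf (t ^+ k))) rmorph_sum.
  by apply: eq_bigr => j _; rewrite rmorphZ_num !mxE mulrC.
have : \det (E *m Y) != 0.
  rewrite -VE det_tr det_Vandermonde.
  apply/prodf_neq0 => i _; apply/prodf_neq0 => j ij.
  by rewrite !mxE subr_eq0 nth_uniq ?szrs // gtn_eqF.
by rewrite det_mulmx mulf_eq0 negb_or unitmxE unitfE => /andP[].
Qed.


End Embeddings.

Lemma real_complex_ratr (R : realType) (a : rat) : (ratr a : R)%:C = ratr a.
Proof. exact: (fmorph_eq_rat (real_complex R \o ratr)). Qed.

(** * Norm, trace and discriminant in terms of conjugates; integrality *)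

Section TraceNorm.
Variables (R : realType) (K : fieldExtType rat).
Local Notation C := R[i].
Local Notation d := (\dim {:K}).
Variable s : 'I_d -> {rmorphism K -> C}.
Hypothesis s_free : (\matrix_(i, k) s i (vbasis {:K})`_k) \in unitmx.

Lemma mul_mxE (x : K) (j k : 'I_d) :
  mul_mx x j k = coord (vbasis {:K}) k (x * (vbasis {:K})`_j).
Proof.
have := passmx.mul_mxof (vbasis {:K}) (vbasis {:K}) (amull x) 'e_j.
rewrite -rowE passmx.vecof_delta lfunE /= => /(congr1 (fun u : 'rV_d => u 0 k)).
by rewrite !mxE.
Qed.

Lemma mul_mx_sum (x : K) (j : 'I_d) :
  x * (vbasis {:K})`_j = \sum_k mul_mx x j k *: (vbasis {:K})`_k.
Proof.
rewrite {1}(coord_vbasis (memvf (x * _))).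
by apply: eq_bigr => k _; rewrite mul_mxE.
Qed.

(** The embeddings diagonalise all multiplications simultaneously, with the conjugates of [x] as
    eigenvalues. Determinant and trace then give the two formulas that follow. *)
Lemma mul_mx_diag (x : K) :
  let E := \matrix_(i, k) s i (vbasis {:K})`_k in
  map_mx ratr (mul_mx x)^T = invmx E *m diag_mx (\row_i s i x) *m E.
Proof.
move=> E; rewrite -mulmxA; apply: (canRL (mulKmx s_free)).
rewrite mul_diag_mx; apply/matrixP => i j; rewrite !mxE -rmorphM mul_mx_sum rmorph_sum.
by apply: eq_bigr => k _; rewrite rmorphZ_num !mxE mulrC.
Qed.

Lemma field_norm_prod (x : K) : ratr (field_norm x) = \prod_i s i x.
Proof.
rewrite /field_norm -det_tr -det_map_mx mul_mx_diag !det_mulmx mulrAC -det_mulmx.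
rewrite mulVmx // det1 mul1r det_diag; apply: eq_bigr => i _; rewrite mxE //.
Qed.

Lemma field_trace_sum (x : K) : ratr (field_trace x) = \sum_i s i x.
Proof.
rewrite /field_trace -mxtrace_tr -trace_map_mx mul_mx_diag mxtrace_mulC mulmxA.
rewrite mulmxV // mul1mx mxtrace_diag; apply: eq_bigr => i _; rewrite mxE //.
Qed.

Definition emb_mx (w : 'I_d -> K) : 'M[C]_d := \matrix_(i, k) s i (w k).

Definition trace_disc (w : 'I_d -> K) : rat :=
  \det (\matrix_(i, j) field_trace (w i * w j)).

Lemma trace_disc_sqr (w : 'I_d -> K) : ratr (trace_disc w) = \det (emb_mx w) ^+ 2.
Proof.
rewrite expr2 -{1}det_tr -det_mulmx -det_map_mx; congr (\det _).
apply/matrixP => i j; rewrite !mxE /= field_trace_sum.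
by apply: eq_bigr => k _; rewrite /emb_mx !mxE rmorphM.
Qed.

Lemma integral_emb i (x : K) : ring_of_integers x ->
  integralOver (intr : int -> C) (s i x).
Proof.
move=> [p pm /rootP px]; exists p => //; apply/rootP.
have -> : map_poly (intr : int -> C) p = map_poly (s i) (map_poly (intr : int -> K) p).
  by rewrite -map_poly_comp; apply: eq_map_poly => a /=; rewrite rmorph_int.
by rewrite horner_map px rmorph0.
Qed.

(** The monic equation descends to the rationals and is transported to [algC], where rational
    algebraic integers are known to be integers. *)
Lemma integral_ratr_int (a : rat) :
  integralOver (intr : int -> C) (ratr a) -> exists m : int, a = m%:~R.
Proof.
move=> [p pm /rootP pa].
have pQ : (map_poly (intr : int -> rat) p).[a] = 0.
  apply: (fmorph_inj (ratr : rat -> C)); rewrite rmorph0 -horner_map -map_poly_comp.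
  by rewrite -[RHS]pa; congr (_.[_]); apply: eq_map_poly => m /=; rewrite rmorph_int.
have : (ratr a : algC) \in Aint.
  apply: (@root_monic_Aint (map_poly (intr : int -> algC) p)); last first.
  - by apply/polyOverP => i; rewrite coef_map /= intr_int.
  - by rewrite monic_map.
  apply/rootP; have := congr1 (ratr : rat -> algC) pQ.
  rewrite rmorph0 -horner_map -map_poly_comp => h; rewrite -[RHS]h.
  by congr (_.[_]); apply: eq_map_poly => m /=; rewrite rmorph_int.
move=> /Cint_rat_Aint -/(_ (Crat_rat _)) /intrP[m am]; exists m.
by apply: (fmorph_inj (ratr : rat -> algC)); rewrite rmorph_int.
Qed.

Lemma integral_prod (I : finType) (f : I -> C) :
  (forall i, integralOver (intr : int -> C) (f i)) ->
  integralOver (intr : int -> C) (\prod_i f i).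
Proof.
move=> fi; elim/big_ind: _ => // [|x y]; first exact: integral1.
exact: integral_mul.
Qed.

Lemma integral_det (A : 'M[C]_d) :
  (forall i j, integralOver (intr : int -> C) (A i j)) ->
  integralOver (intr : int -> C) (\det A).
Proof.
move=> Ai; rewrite /determinant; elim/big_ind: _ => [|x y|g _].
- exact: integral0.
- exact: integral_add.
apply: integral_mul; last exact: integral_prod.
by rewrite -[(-1) ^+ _](rmorph_sign (intr : int -> C)); exact: integral_id.
Qed.

Lemma field_norm_int (x : K) : ring_of_integers x ->
  exists m : int, field_norm x = m%:~R.
Proof.
move=> xi; apply: integral_ratr_int; rewrite field_norm_prod.
by apply: integral_prod => i; exact: integral_emb.
Qed.

Lemma trace_disc_int (w : 'I_d -> K) : (forall k, ring_of_integers (w k)) ->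
  exists m : int, trace_disc w = m%:~R.
Proof.
move=> wi; apply: integral_ratr_int; rewrite trace_disc_sqr.
have h : integralOver (intr : int -> C) (\det (emb_mx w)).
  by apply: integral_det => i j; rewrite /emb_mx mxE; exact: integral_emb.
by rewrite expr2; exact: integral_mul.
Qed.

(** The norm is a rational integer, and a product of nonzero conjugates. This is what excludes a
    collision between translates with the same [j]. *)
Lemma field_norm_ge1 (x : K) : ring_of_integers x -> x != 0 -> 1 <= `|field_norm x|.
Proof.
move=> xi x0; have [m mE] := field_norm_int xi.
have : field_norm x != 0.
  rewrite -(fmorph_eq0 (ratr : rat -> C)) /= field_norm_prod.
  by apply/prodf_neq0 => i _; rewrite fmorph_eq0.
rewrite mE intr_eq0 -intr_norm ler1z; lia.
Qed.

Lemma field_norm_lt (x : K) (e : R) : (forall i, `|s i x| < e%:C) ->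
  ratr `|field_norm x| < e ^+ d.
Proof.
move=> h; have dpos : (0 < d)%N := adim_gt0 (aspacef K).
rewrite -ltcR; have -> : (ratr `|field_norm x|)%:C = `|ratr (field_norm x)| :> C.
  by rewrite real_complex_ratr ratr_norm.
rewrite field_norm_prod normr_prod rmorphXn /=.
have -> : e%:C ^+ d = \prod_(i < d) e%:C by rewrite prodr_const card_ord.
apply: ltr_prod => [|i _]; last by rewrite normr_ge0 h.
by apply/hasP; exists (Ordinal dpos); rewrite // mem_index_enum.
Qed.

End TraceNorm.

(** * Integral bases *)

Lemma common_denominator (I : finType) (a : I -> rat) :
  exists2 D : int, D != 0 & forall i, exists m : int, D%:~R * a i = m%:~R.
Proof.
exists (\prod_i denq (a i)).
  by apply/prodf_neq0 => i _; exact: denq_neq0.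
move=> i; exists (numq (a i) * \prod_(j | j != i) denq (a j)).
by rewrite (bigD1 i) //= !rmorphM /= numqE; ring.
Qed.

Lemma det_col_id (F : comNzRingType) n (Q : 'M[F]_n) (k : 'I_n) :
  (forall i j, j != k -> Q i j = (i == j)%:R) -> \det Q = Q k k.
Proof.
move=> Qid; rewrite (expand_det_row Q k) (bigD1 k) //= big1 ?addr0 => [|j jk].
  rewrite /cofactor (_ : row' k (col' k Q) = 1%:M) ?det1 ?mulr1.
    by rewrite addnn -mul2n exprM sqrrN !expr1n mulr1.
  apply/matrixP => i j; rewrite !mxE Qid ?(inj_eq lift_inj) //.
  by rewrite eq_sym neq_lift.
by rewrite Qid // eq_sym (negbTE jk) mul0r.
Qed.

Section IntegralBasis.
Variables (R : realType) (K : fieldExtType rat).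
Local Notation C := R[i].
Local Notation d := (\dim {:K}).
Variable s : 'I_d -> {rmorphism K -> C}.
Hypothesis s_free : (\matrix_(i, k) s i (vbasis {:K})`_k) \in unitmx.

(** The row of basis vectors is an eigenvector, for the eigenvalue [x], of an integer matrix; so [x]
    is a root of its characteristic polynomial, which is monic. *)
Lemma integral_int_mul_mx (x : K) :
  (forall j k, exists m : int, mul_mx x j k = m%:~R) -> ring_of_integers x.
Proof.
move=> h; have [|N NP] := @choice _ _
  (fun j (f : 'I_d -> int) => forall k, mul_mx x j k = (f k)%:~R).
  by move=> j; have [f fP] := choice (h j); exists f.
pose Nm : 'M[int]_d := \matrix_(k, j) N j k.
exists (char_poly Nm); first exact: char_poly_monic.
rewrite map_char_poly -eigenvalue_root_char; apply/eigenvalueP.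
exists (\row_k (vbasis {:K})`_k).
  apply/rowP => j; rewrite !mxE mul_mx_sum; apply: eq_bigr => k _.
  by rewrite NP !mxE scaler_int mulrzr.
apply/eqP => /rowP /(_ (Ordinal (adim_gt0 (aspacef K)))); rewrite !mxE.
apply/eqP; apply: free_not0 (basis_free (vbasisP {:K})) _.
by rewrite mem_nth // size_tuple.
Qed.

Lemma emb_mx_mulmx (w w' : 'I_d -> K) (Q : 'M[rat]_d) :
  (forall k, w' k = \sum_j Q j k *: w j) ->
  emb_mx s w' = emb_mx s w *m map_mx ratr Q.
Proof.
move=> h; apply/matrixP => i k; rewrite /emb_mx !mxE h rmorph_sum.
by apply: eq_bigr => j _; rewrite rmorphZ_num !mxE mulrC.
Qed.

Lemma trace_disc_mulmx (w w' : 'I_d -> K) (Q : 'M[rat]_d) :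
  (forall k, w' k = \sum_j Q j k *: w j) ->
  trace_disc w' = trace_disc w * \det Q ^+ 2.
Proof.
move=> /emb_mx_mulmx h; apply: (fmorph_inj (ratr : rat -> C)) => /=.
rewrite rmorphM rmorphXn /= !(trace_disc_sqr s_free) h det_mulmx det_map_mx.
by rewrite exprMn.
Qed.

Lemma trace_disc_basis (w : d.-tuple K) :
  trace_disc (fun k => w`_k) != 0 -> basis_of {:K} w.
Proof.
rewrite -(fmorph_eq0 (ratr : rat -> C)) /= (trace_disc_sqr s_free) sqrf_eq0.
set E := emb_mx s _ => dw.
rewrite basisEfree subvf size_tuple leqnn !andbT; apply/freeP => a a0 i.
have aE : E *m (\col_j ratr (a j)) = 0.
  apply/matrixP => l z; have := congr1 (s l) a0; rewrite rmorph0 rmorph_sum => /esym h.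
  rewrite /E /emb_mx !mxE [RHS]h.
  by apply: eq_bigr => j _; rewrite !mxE rmorphZ_num mulrC.
have uE : E \in unitmx by rewrite unitmxE unitfE.
have := congr1 (mulmx (invmx E)) aE.
rewrite mulKmx // mulmx0 => /matrixP /(_ i 0); rewrite !mxE.
by move/eqP; rewrite fmorph_eq0 => /eqP.
Qed.

Lemma trace_disc_vbasis_neq0 : trace_disc (fun k : 'I_d => (vbasis {:K})`_k) != 0.
Proof.
rewrite -(fmorph_eq0 (ratr : rat -> C)) /= (trace_disc_sqr s_free).
by apply: expf_neq0; move: s_free; rewrite unitmxE unitfE.
Qed.

(** Scale a basis by a common denominator [D] of its multiplication tables: the multiplication
    matrices become integral, and the discriminant is multiplied by a nonzero square. *)
Lemma integral_disc_neq0 : exists w : 'I_d -> K,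
  (forall k, ring_of_integers (w k)) /\ trace_disc w != 0.
Proof.
have [D D0 DP] := common_denominator
  (fun i : 'I_d * 'I_d * 'I_d => mul_mx (vbasis {:K})`_i.1.1 i.1.2 i.2).
pose w (k : 'I_d) : K := (D%:~R : rat) *: (vbasis {:K})`_k.
exists w; split => [k|].
  apply: integral_int_mul_mx => j l; have [m mE] := DP (k, j, l); exists m.
  by rewrite -mE !mul_mxE /w -scalerAl linearZ.
rewrite (@trace_disc_mulmx (fun k => (vbasis {:K})`_k) w (D%:~R)%:M).
  by rewrite mulf_neq0 ?trace_disc_vbasis_neq0 // det_scalar !expf_neq0 // intr_eq0.
move=> k; rewrite (bigD1 k) //= big1 ?addr0 => [|j jk].
  by rewrite mxE eqxx.
by rewrite mxE (negbTE jk) scale0r.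
Qed.

(* A family of integers of K with nonzero discriminant of least absolute value is
   an integral basis: otherwise replacing some w_k by an integer whose k-th
   coordinate lies in ]0, 1[ would give a smaller one. *)
Lemma integral_basis_exists : exists w : d.-tuple K, is_integral_basis w.
Proof.
pose P n := (exists w : 'I_d -> K, [/\ forall k, ring_of_integers (w k),
  `|trace_disc w| = n%:R :> rat & (0 < n)%N]).
have toP (w : 'I_d -> K) : (forall k, ring_of_integers (w k)) -> trace_disc w != 0 ->
    exists2 n, P n & `|trace_disc w| = n%:R.
  move=> wi w0; have [m mE] := trace_disc_int s_free wi.
  have nE : `|trace_disc w| = `|m|%:R by rewrite mE -intr_norm -abszE.
  exists `|m|%N => //; exists w; split => //.
  by rewrite absz_gt0 -(intr_eq0 rat) -mE.
have exP : exists n, `[< P n >].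
  have [w [wi w0]] := integral_disc_neq0.
  by have [n nP _] := toP w wi w0; exists n; apply/asboolP.
case: (ex_minnP exP) => n /asboolP[w [wi wn n0]] nmin.
have w0 : trace_disc w != 0 by rewrite -normr_eq0 wn pnatr_eq0 -lt0n.
have [wt wtE] : exists wt : d.-tuple K, forall k : 'I_d, wt`_k = w k.
  by exists (mktuple w) => k; rewrite nth_mktuple.
have wB : basis_of {:K} wt.
  by apply: trace_disc_basis; rewrite (_ : (fun k => _) = w) //; exact/funext.
exists wt; split => //.
apply/seteqP; split => [x xi|x [a ->]]; last first.
  apply: big_ind => [|y z|k _]; first exact: integral0.
    exact: integral_add.
  rewrite wtE -mulrzr; apply: integral_mul; [exact: wi|exact: integral_id].
pose q k := coord wt k x.
have xq : x = \sum_k q k *: w k.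
  rewrite {1}(coord_basis wB (memvf x)); apply: eq_bigr => k _.
  by rewrite wtE.
suff h k : exists m : int, q k = m%:~R.
  have [a aE] := choice h; exists a; rewrite {1}xq; apply: eq_bigr => k _.
  by rewrite wtE aE scaler_int.
pose t := Num.floor (q k); exists t; apply/eqP; rewrite -subr_eq0; apply/negPn/negP => f0.
set f := q k - t%:~R in f0.
have [f_ge0 f_lt1] : 0 <= f /\ f < 1.
  by have /andP[] := floor_itv (q k); rewrite -/t rmorphD /= /f => ? ?; split; lra.
pose w' j := if j == k then x - w k *~ t else w j.
(* [Q] is the identity outside column [k], so its determinant is the diagonal entry [f], and the
   discriminant shrinks by the factor [f ^+ 2 < 1]. *)
pose Q : 'M[rat]_d := \matrix_(i, j)
  if j == k then q i - (i == k)%:R * t%:~R else (i == j)%:R.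
have dQ : \det Q = f.
  rewrite (det_col_id (k := k)) => [|i j jk]; rewrite mxE.
    by rewrite eqxx mul1r.
  by rewrite (negbTE jk).
have disc' : trace_disc w' = trace_disc w * f ^+ 2.
  rewrite -dQ; apply: trace_disc_mulmx => j; rewrite /w'.
  have [->|jk] := eqVneq j k.
    rewrite {1}xq (bigD1 k) //= [in RHS](bigD1 k) //= mxE !eqxx mul1r.
    rewrite addrAC -scaler_int -scalerBl; congr (_ + _).
    by apply: eq_bigr => i ik; rewrite mxE eqxx (negbTE ik) mul0r subr0.
  rewrite (bigD1 j) //= big1 ?addr0 => [|i ij]; first by rewrite mxE (negbTE jk) eqxx scale1r.
  by rewrite mxE (negbTE jk) (negbTE ij) scale0r.
have wi' j : ring_of_integers (w' j).
  rewrite /w'; case: ifP => // _; apply: integral_sub => //.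
  by rewrite -mulrzr; apply: integral_mul; [exact: wi|exact: integral_id].
have [|n' n'P n'E] := toP w' wi'; first by rewrite disc' mulf_neq0 ?expf_neq0.
have := nmin n'; rewrite asboolT // => /(_ isT); rewrite -(ler_nat rat) -n'E disc'.
rewrite normrM wn; apply/negP; rewrite -ltNge gtr_pMr ?ltr0n //.
by rewrite ger0_norm ?exprn_ge0 // expr_lt1.
Qed.

Lemma integral_basisP : is_integral_basis (integral_basis K).
Proof. exact: (xgetPex (vbasis {:K}) integral_basis_exists). Qed.

End IntegralBasis.

(** * Complex conjugation and the covolume *)

(** The orbits are fixed points and pairs, each pair being represented by its smaller index. For
    conjugation these are the real embeddings and the pairs of complex ones. *)
Lemma big_involution (T : Type) (idx : T) (op : Monoid.com_law idx) n
    (c : 'I_n -> 'I_n) (F : 'I_n -> T) : involutive c ->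
  \big[op/idx]_i F i =
  op (\big[op/idx]_(i | c i == i) F i)
     (\big[op/idx]_(i : 'I_n | (i < c i)%N) op (F i) (F (c i))).
Proof.
move=> cK; rewrite (bigID (fun i => c i == i)) /=; congr (op _ _).
rewrite (bigID (fun i : 'I_n => (i < c i)%N)) /= big_split /=; congr (op _ _).
  by apply: eq_bigl => i; case: ltngtP => [||/val_inj ->]; rewrite ?eqxx ?andbF ?andbT //;
     move=> h; rewrite -(inj_eq val_inj) /= ?(ltn_eqF h) ?(gtn_eqF h).
rewrite (reindex_inj (inv_inj cK)) /=; apply: eq_bigl => i; rewrite cK.
rewrite -leqNgt -(inj_eq val_inj) /=; case: ltngtP => //.
Qed.

Lemma card_involution n (c : 'I_n -> 'I_n) : involutive c ->
  (#|[pred i | c i == i]| + 2 * #|[pred i : 'I_n | (i < c i)%N]| = n)%N.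
Proof.
move=> cK; have : (\sum_(i < n) 1 = n)%N by rewrite sum1_card card_ord.
by rewrite (big_involution _ _ cK) /= big_split /= !sum1_card mul2n addnn.
Qed.

Section Conjugation.
Variables (R : realType) (K : fieldExtType rat).
Local Notation C := R[i].
Local Notation d := (\dim {:K}).
Variable s : 'I_d -> {rmorphism K -> C}.
Hypothesis s_free : (\matrix_(i, k) s i (vbasis {:K})`_k) \in unitmx.
Hypothesis s_all : forall f : {rmorphism K -> C}, exists i, f =1 s i.

Lemma emb_inj i j : s i =1 s j -> i = j.
Proof.
move=> ij; apply/eqP/negPn/negP => neq.
move: s_free; rewrite unitmxE unitfE (determinant_alternate neq) ?eqxx //.
by move=> k; rewrite !mxE ij.
Qed.

(** Conjugating an embedding gives an embedding, hence one of the list; distinctness of the [s i]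
    makes this permutation an involution. *)
Lemma exists_emb_conj : exists c : 'I_d -> 'I_d,
  involutive c /\ forall i x, s (c i) x = conjc (s i x).
Proof.
have [c cE] := choice (fun i => s_all (conjc \o s i)).
exists c; split => [i|i x]; last by rewrite -cE.
by apply: emb_inj => x; rewrite -!cE /= -cE /= conjcK.
Qed.

Variable c : 'I_d -> 'I_d.
Hypothesis cK : involutive c.
Hypothesis sc : forall i x, s (c i) x = conjc (s i x).

Lemma emb_realP i : c i = i <-> @is_real_embedding K R (s i).
Proof.
split => [ci x|h]; last first.
  by apply: emb_inj => x; rewrite sc; move: (h x); case: (s i x) => a b /= ->; rewrite oppr0.
have := sc i x; rewrite ci; case: (s i x) => a b [] /= h; lra.
Qed.

Lemma r2E : r2 K R = #|[pred i : 'I_d | (i < c i)%N]|.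
Proof.
pose P := [pred i : 'I_d | c i != i].
have cardP : #|P| = (#|[pred i : 'I_d | (i < c i)%N]|).*2.
  rewrite -!sum1_card big_mkcond /= (big_involution _ _ cK) /=.
  rewrite big1 => [|i ci]; last by rewrite unfold_in /= ci.
  rewrite add0n -muln2 big_distrl /=; apply: eq_bigr => i ic.
  rewrite !unfold_in /= cK [i == _]eq_sym -(inj_eq val_inj) /= gtn_eqF //.
rewrite -[RHS]doubleK -cardP /r2; congr (_./2).
have -> : @embeddings K R `\` @is_real_embedding K R =
    (fun i : 'I_d => (s i : K -> C)) @` [set i | P i].
  apply/seteqP; split => [f [[g ->] nr]|f [i /= ci <-]].
    have [i gi] := s_all g; have gE : (g : K -> C) = s i by exact/funext.
    by exists i; [apply/eqP => /emb_realP; rewrite -gE|rewrite gE].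
  by split; [exists (s i)|move/emb_realP/eqP; apply/negP].
rewrite fset_set_image; last exact: finite_finset.
rewrite card_imfset /=; last first.
  by move=> i j ij; apply: emb_inj => x; exact: (congr1 (fun f => f x) ij).
have -> : fset_set [set i | P i] = [fset i in P]%fset.
  apply/fsetP => i; rewrite in_fset_set; last exact: finite_finset.
  by rewrite in_fset; apply/idP/idP => [/set_mem|h]; [|apply/mem_set].
by rewrite card_imfset //= -cardE.
Qed.

(* Real coordinates on Minkowski space: of two conjugate embeddings the one of
   smaller index contributes the real part, the other one the imaginary part. *)
Definition emb_coord (i : 'I_d) (x : K) : R :=
  if (i <= c i)%N then complex.Re (s i x) else complex.Im (s i x).

Definition coord_mx (w : 'I_d -> K) : 'M[R]_d := \matrix_(i, k) emb_coord i (w k).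

(** For a conjugate pair, [conj(z) z' + z conj(z')] is twice the real scalar product of [z] and
    [z']: both coordinates of the pair get weight 2. *)
Lemma emb_gram x y : \sum_i conjc (s i x) * s i y =
  (\sum_i (if c i == i then 1 else 2) * (emb_coord i x * emb_coord i y))%:C.
Proof.
rewrite rmorph_sum /= !(big_involution _ _ cK) /=; congr (_ + _).
  apply: eq_bigr => i /eqP ci; rewrite ci eqxx mul1r /emb_coord ci leqnn.
  have := sc i x; have := sc i y; rewrite ci.
  case: (s i x) => a b; case: (s i y) => a' b' [h'] [h].
  have -> : b = 0 by lra.
  have -> : b' = 0 by lra.
  by apply/eqP; rewrite eq_complex /=; apply/andP; split; apply/eqP; ring.
apply: eq_bigr => i ic; rewrite /emb_coord cK (ltnW ic) leqNgt ic /= !sc.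
rewrite [i == c i]eq_sym -(inj_eq val_inj) /= gtn_eqF //.
case: (s i x) => a b; case: (s i y) => a' b' /=.
by apply/eqP; rewrite eq_complex /=; apply/andP; split; apply/eqP; ring.
Qed.

(** The discriminant has the absolute value of the Hermitian Gram determinant. By [emb_gram] this is
    the real one times the product of the weights, which is [4 ^+ r2]. *)
Lemma sqrt_trace_disc (w : 'I_d -> K) :
  Num.sqrt `|ratr (trace_disc w)| = 2 ^+ r2 K R * `|\det (coord_mx w)|.
Proof.
have h : conjc (\det (emb_mx s w)) * \det (emb_mx s w) =
    (4 ^+ r2 K R * \det (coord_mx w) ^+ 2)%:C.
  rewrite -det_map_mx -det_tr -det_mulmx.
  pose D : 'rV[R]_d := \row_i (if c i == i then 1 else 2).
  have -> : (map_mx conjc (emb_mx s w))^T *m emb_mx s w =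
      map_mx (real_complex R) ((coord_mx w)^T *m diag_mx D *m coord_mx w).
    apply/matrixP => k l; rewrite -mulmxA mul_diag_mx !mxE.
    transitivity (\sum_i conjc (s i (w k)) * s i (w l)).
      by apply: eq_bigr => i _; rewrite !mxE.
    rewrite emb_gram; congr (_%:C); apply: eq_bigr => i _; rewrite !mxE; ring.
  rewrite det_map_mx !det_mulmx det_tr det_diag; congr (_%:C).
  suff -> : \prod_i D 0 i = 4 ^+ r2 K R by rewrite mulrAC mulrC -expr2.
  rewrite (big_involution _ _ cK) /= big1 => [|i ci]; last by rewrite mxE ci.
  rewrite mul1r r2E -prodr_const; apply: eq_bigr => i ic.
  rewrite !mxE cK [i == c i]eq_sym -(inj_eq val_inj) /= gtn_eqF //; ring.
have absE : `|ratr (trace_disc w)| = 4 ^+ r2 K R * \det (coord_mx w) ^+ 2 :> R.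
  apply: (@complexI R); rewrite -h mulrC -sqr_normc -normrX -trace_disc_sqr //.
  by rewrite -!ratr_norm real_complex_ratr.
rewrite absE.
have -> : 4 ^+ r2 K R = (2 ^+ r2 K R) ^+ 2 :> R by rewrite exprAC; congr (_ ^+ _); ring.
by rewrite -exprMn sqrtr_sqr normrM normrX ger0_norm.
Qed.

End Conjugation.

(** * Cosets of an ideal *)

Section IdealCosets.
Variables (R : realType) (K : fieldExtType rat).
Local Notation C := R[i].
Local Notation d := (\dim {:K}).
Variable s : 'I_d -> {rmorphism K -> C}.
Hypothesis s_free : (\matrix_(i, k) s i (vbasis {:K})`_k) \in unitmx.

Lemma integral_multiple (x : K) :
  exists2 D : int, D != 0 & ring_of_integers (D%:~R * x).
Proof.
have [D D0 DP] := common_denominator (fun i : 'I_d * 'I_d => mul_mx x i.1 i.2).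
exists D => //; apply: integral_int_mul_mx => j k; have [m mE] := DP (j, k); exists m.
have -> : D%:~R * x = (D%:~R : rat) *: x by rewrite mulrzl scaler_int.
by rewrite -mE !mul_mxE -scalerAl linearZ.
Qed.

Variable A : set K.
Hypothesis A_ideal : integral_ideal A.

Lemma idealN x : A x -> A (- x).
Proof.
case: A_ideal => _ _ _ Am Ax; rewrite -mulN1r; apply: Am => //.
by apply: integral_opp; exact: integral1.
Qed.

Lemma ideal_coset_eqP x y : ideal_coset A x = ideal_coset A y <-> A (x - y).
Proof.
case: (A_ideal) => _ A0 Aadd _; split => [xy|Axy].
  suff : ideal_coset A y x by [].
  by rewrite -xy /ideal_coset /= subrr.
apply/seteqP; split => z /= Az; rewrite /ideal_coset /=.
  by rewrite -(subrKA x); apply: Aadd.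
by rewrite -(subrKA y); apply: Aadd => //; rewrite -opprB; exact: idealN.
Qed.

Hypothesis A_neq0 : exists2 a, A a & a != 0.

(** If [D / a] is integral with [a] in the ideal, then [D = (D / a) a] lies in the ideal. *)
Lemma ideal_int_neq0 : exists2 D : int, D != 0 & A D%:~R.
Proof.
have [a Aa a0] := A_neq0; have [D D0 Di] := integral_multiple a^-1; exists D => //.
rewrite (_ : D%:~R = D%:~R * a^-1 * a); last by rewrite mulfVK.
by case: A_ideal => _ _ _; apply.
Qed.

(** Since the ideal contains a nonzero integer [D], reducing the coordinates on an integral basis
    modulo [D] does not change the coset; at most [|D| ^ d] cosets remain. *)
Lemma finite_ideal_cosets : finite_set (ideal_coset A @` @ring_of_integers K).
Proof.
have [_ OE] := integral_basisP s_free.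
have [D D0 AD] := ideal_int_neq0; set w := integral_basis K in OE.
pose g (f : {ffun 'I_d -> 'I_`|D|}) := ideal_coset A (\sum_(i < d) w`_i *+ f i).
apply: (@sub_finite_set _ _ (range g)); last by apply: finite_image; exact: finite_finset.
move=> _ [x xO <-]; move: (xO); rewrite {1}OE => -[a xE].
have lt (i : 'I_d) : (`|(a i %% D)%Z| < `|D|)%N.
  by have := ltz_mod (a i) D0; have := modz_ge0 (a i) D0; lia.
exists [ffun i => Ordinal (lt i)] => //; apply/esym/ideal_coset_eqP.
rewrite xE -sumrB; case: (A_ideal) => _ A0 Aadd Amul.
apply: big_ind => // i _; rewrite ffunE /=.
have -> : w`_i *~ a i - w`_i *+ `|(a i %% D)%Z|%N = (w`_i *~ (a i %/ D)%Z) * D%:~R.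
  have r0 := modz_ge0 (a i) D0; rewrite pmulrn gez0_abs //.
  by rewrite {1}(divz_eq (a i) D) mulrzDr addrK mulrzA mulrzr.
apply: Amul => //; rewrite OE; exists (fun k => if k == i then (a i %/ D)%Z else 0).
by rewrite (bigD1 i) //= eqxx big1 ?addr0 // => k /negbTE ->.
Qed.

Lemma ideal_norm_classes : exists k : K -> 'I_(ideal_norm A),
  forall x y, ring_of_integers x -> ring_of_integers y -> k x = k y -> A (x - y).
Proof.
pose F := fset_set (ideal_coset A @` @ring_of_integers K).
have memF x : ring_of_integers x -> ideal_coset A x \in F.
  by move=> xO; rewrite in_fset_set; [apply: mem_set; exists x|exact: finite_ideal_cosets].
have lt x : ring_of_integers x -> (index (ideal_coset A x) F < ideal_norm A)%N.
  by move=> /memF; rewrite -index_mem.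
have lt0 := lt _ (integral0 _).
have h (x : K) : exists k : 'I_(ideal_norm A),
    ring_of_integers x -> nth set0 F k = ideal_coset A x.
  (* Outside the ring of integers the label is arbitrary. Label 0 exists because 0 has a coset. *)
  have [xO|xO] := pselect (ring_of_integers x); last by exists (Ordinal lt0).
  by exists (Ordinal (lt x xO)) => _ /=; rewrite nth_index ?memF.
have [k kP] := choice h; exists k => x y xO yO kxy.
by apply/ideal_coset_eqP; rewrite -!kP // kxy.
Qed.

End IdealCosets.

(** * Rounding the lattice *)

Definition floor_mx (R : realType) m n (t : R) (B : 'M[R]_(m, n)) : 'M[int]_(m, n) :=
  \matrix_(i, j) Num.floor (t * B i j).

Section Asymptotics.
Variable R : realType.

Lemma cvg_det d (A : nat -> 'M[R]_d) (B : 'M[R]_d) :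
  (forall i j, A l i j @[l --> \oo] --> B i j) -> \det (A l) @[l --> \oo] --> \det B.
Proof.
move=> AB; rewrite /determinant.
have h (r : seq 'S_d) : (\sum_(g <- r) (-1) ^+ g * \prod_i A l i (g i)) @[l --> \oo] -->
    (\sum_(g <- r) (-1) ^+ g * \prod_i B i (g i)).
  elim: r => [|g r IH].
    under eq_fun do rewrite big_nil.
    by rewrite big_nil; exact: cvg_cst.
  under eq_fun do rewrite big_cons.
  rewrite big_cons; apply: cvgD => //; apply: cvgM; first exact: cvg_cst.
  elim: (index_enum _) => [|i t IHt].
    under eq_fun do rewrite big_nil.
    by rewrite big_nil; exact: cvg_cst.
  under eq_fun do rewrite big_cons.
  by rewrite big_cons; apply: cvgM.
exact: h.
Qed.

Lemma cvg_exprn (u : nat -> R) (a : R) n :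
  u l @[l --> \oo] --> a -> u l ^+ n @[l --> \oo] --> a ^+ n.
Proof.
move=> ua; elim: n => [|n IH]; first exact: cvg_cst.
under eq_fun do rewrite exprS.
by rewrite exprS; apply: cvgM.
Qed.

Lemma cvg_floor_ratio (t : R) : (Num.floor (t * l.+1%:R))%:~R / l.+1%:R @[l --> \oo] --> t.
Proof.
apply: (@squeeze_cvgr _ _ _ _ (fun l => t - l.+1%:R^-1) (fun=> t)).
- near=> l; have l0 : 0 < l.+1%:R :> R by rewrite ltr0n.
  rewrite ler_pdivlMr // ler_pdivrMr // mulrBl mulVf ?lt0r_neq0 //.
  have /andP[] := floor_itv (t * l.+1%:R); rewrite rmorphD /= => -> ?.
  by rewrite andbT; lra.
- by rewrite -[X in _ --> X]subr0; apply: cvgB; [exact: cvg_cst|exact: cvg_harmonic].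
- exact: cvg_cst.
Unshelve. all: by end_near. Qed.

(** Divide both counts by [L ^ d]: the determinant tends to [k ^+ d * \det B], while
    [(2L + 1) / L >= 2] and the disc count over [L ^ 2] is at least a quantity tending to [pi]. The
    strict inequality between the limits then holds for all large [L]. *)
Lemma det_floor_mx_asymptotics d (B : 'M[R]_d) (k : R) (r1 r2 n M : nat) :
  (r1 + 2 * r2 = d)%N -> 0 < k -> \det B != 0 ->
  k ^+ d * `|\det B| * n%:R < M%:R * (2 ^+ r1 * pi ^+ r2) ->
  exists L0, forall L, (L0 < L)%N ->
    \det (floor_mx (k * L%:R) B) != 0 /\
    (`|\det (floor_mx (k * L%:R) B)| * n < M * ((2 * L).+1 ^ r1 * #|int_disc L| ^ r2))%N.
Proof.
move=> dE k0 dB hlt.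
pose h (l : nat) : R := l.+1%:R^-1.
pose u (l : nat) : R := (\det (floor_mx (k * l.+1%:R) B))%:~R * h l ^+ d.
have ucvg : u l @[l --> \oo] --> k ^+ d * \det B.
  rewrite -detZ; have uE l : u l = \det (h l *: map_mx intr (floor_mx (k * l.+1%:R) B)).
    by rewrite detZ det_map_mx mulrC.
  under eq_fun do rewrite uE.
  apply: cvg_det => i j; rewrite mxE.
  have eE l : (h l *: map_mx intr (floor_mx (k * l.+1%:R) B)) i j =
      (Num.floor ((k * B i j) * l.+1%:R))%:~R / l.+1%:R :> R.
    by rewrite !mxE mulrC mulrAC.
  by under eq_fun do rewrite eE; exact: cvg_floor_ratio.
have hcvg : h l @[l --> \oo] --> (0 : R) by exact: cvg_harmonic.
(* Lower bound of [card_int_disc_ge] divided by [L ^ 2], for [L = l.+1]; the shift avoids dividing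
   by 0. *)
pose v (l : nat) : R := pi - 4 * h l - h l ^+ 2.
have vcvg : v l @[l --> \oo] --> (pi : R).
  rewrite -[X in _ --> X]subr0 -[X in _ --> X - _]subr0.
  apply: cvgB; [apply: cvgB; first exact: cvg_cst|].
    by rewrite -(mulr0 4); apply: cvgM => //; exact: cvg_cst.
  by have := cvg_exprn (n := 2) hcvg; rewrite expr0n.
have wcvg : `|u l| * n%:R - M%:R * (2 ^+ r1 * v l ^+ r2) @[l --> \oo] -->
    `|k ^+ d * \det B| * n%:R - M%:R * (2 ^+ r1 * pi ^+ r2).
  apply: cvgB; apply: cvgM; try exact: cvg_cst.
    exact: cvg_norm.
  by apply: cvgM; [exact: cvg_cst|exact: cvg_exprn].
have [] : \forall l \near \oo, \det (floor_mx (k * l.+1%:R) B) != 0 /\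
    (`|\det (floor_mx (k * l.+1%:R) B)| * n < M * ((2 * l.+1).+1 ^ r1 * #|int_disc l.+1| ^ r2))%N.
  near=> l.
  have hl0 : 0 < h l by rewrite invr_gt0 ltr0n.
  have hl : h l * l.+1%:R = 1 by rewrite mulVf // pnatr_eq0.
  have uN0 : 0 < `|u l|.
    near: l; apply: (cvgr_gt _ (cvg_norm ucvg)).
    by rewrite normr_gt0 mulf_neq0 // expf_neq0 // lt0r_neq0.
  have vl0 : 0 < v l by near: l; apply: (cvgr_gt _ vcvg); exact: pi_gt0.
  have wl0 : `|u l| * n%:R - M%:R * (2 ^+ r1 * v l ^+ r2) < 0.
    near: l; apply: (cvgr_lt _ wcvg).
    by rewrite subr_lt0 normrM normrX (gtr0_norm k0).
  split.
    by apply: contraTneq uN0 => d0; rewrite /u d0 mul0r normr0 ltxx.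
  have Ln (a b : nat) : a%:R * h l ^+ d < b%:R * h l ^+ d :> R -> (a < b)%N.
    by rewrite ltr_pM2r ?exprn_gt0 // ltr_nat.
  apply: Ln; move: wl0; rewrite subr_lt0 natrM.
  have -> : `|u l| = `|\det (floor_mx (k * l.+1%:R) B)|%N%:R * h l ^+ d.
    by rewrite /u normrM (ger0_norm (exprn_ge0 _ (ltW hl0))) -intr_norm -abszE.
  rewrite mulrAC => /lt_le_trans; apply.
  rewrite natrM natrM !natrX.
  rewrite (_ : h l ^+ d = h l ^+ r1 * (h l ^+ 2) ^+ r2); last by rewrite -dE exprD exprM.
  set x := (2 * l.+1).+1%:R; set q := #|_|%:R.
  have -> : M%:R * (x ^+ r1 * q ^+ r2) * (h l ^+ r1 * (h l ^+ 2) ^+ r2) =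
      M%:R * ((x * h l) ^+ r1 * (q * h l ^+ 2) ^+ r2).
    rewrite !exprMn; set a := x ^+ _; set b := q ^+ _.
    by set a' := h l ^+ r1; set b' := _ ^+ r2; ring.
  have hx : 2 <= x * h l.
    rewrite /x -[(2 * l.+1).+1%:R]natr1 natrM mulrDl -mulrA [l.+1%:R * _]mulrC hl; lra.
  have hq : v l <= q * h l ^+ 2.
    have -> : v l = (pi * l.+1%:R ^+ 2 - 4 * l.+1%:R - 1) * h l ^+ 2.
      have -> : (pi * l.+1%:R ^+ 2 - 4 * l.+1%:R - 1) * h l ^+ 2 =
        pi * (h l * l.+1%:R) ^+ 2 - 4 * (h l * l.+1%:R) * h l - h l ^+ 2 by ring.
      by rewrite hl /v; ring.
    by rewrite ler_pM2r ?exprn_gt0 //; exact: card_int_disc_ge.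
  rewrite ler_wpM2l // ler_pM ?exprn_ge0 //; first exact: ltW.
    by rewrite lerXn2r ?nnegrE //; lra.
  by rewrite lerXn2r ?nnegrE // ?(ltW vl0) //; apply: le_trans hq; exact: ltW.
move=> N _ NP; exists N => -[//|l] lN; exact: (NP l lN).
Unshelve. all: by end_near. Qed.

End Asymptotics.

(** * Pigeonhole principle and rounding errors *)

Lemma pigeonhole_in (aT rT : finType) (f : aT -> rT) (D : {set aT}) :
  (#|rT| < #|D|)%N -> exists x y, [/\ x \in D, y \in D, x != y & f x = f y].
Proof.
move=> lt; apply: contrapT => h.
have inj : {in D &, injective f}.
  move=> x y xD yD fxy; apply/eqP/negPn/negP => xy; apply: h.
  by exists x, y; split.
by move: lt; rewrite -(card_in_imset inj) ltnNge max_card.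
Qed.

Lemma dist_frac_le1 (F : archiRealFieldType) (x y : F) :
  `|(x - (Num.floor x)%:~R) - (y - (Num.floor y)%:~R)| <= 1.
Proof.
have /andP[] := floor_itv x; have /andP[] := floor_itv y.
by rewrite !rmorphD /= => ? ? ? ?; rewrite ler_norml; apply/andP; split; lra.
Qed.

Lemma ord_sub_itv M (a b : 'I_M) : (b < a)%N -> 0 < a%:Z - b%:Z < M%:Z.
Proof. by have := ltn_ord a; lia. Qed.

(* The coefficients [u] are first bounded through [B^-1]; this makes the total
   rounding error independent of [L]. *)
Lemma floor_mx_perturbation (R : realType) d (B : 'M[R]_d) (k b : R) :
  0 < k -> 0 <= b -> \det B != 0 ->
  exists C : R, exists L0 : nat, forall L : nat, (L0 < L)%N ->
  forall (u a e : 'cV[int]_d) (x : 'cV[R]_d), let t := k * L%:R in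
    (forall i, `|x i 0| <= b) -> (forall i, `|t * x i 0 - (e i 0)%:~R| <= 1) ->
    (forall i, `|a i 0| <= (2 * L)%:Z) -> floor_mx t B *m u = a + e ->
    forall i, `|t * (x i 0 - \sum_j B i j * (u j 0)%:~R) + (a i 0)%:~R| <= C.
Proof.
move=> k0 b0 dB.
pose P := invmx B; pose p := \sum_j \sum_i `|P j i|.
have p0 : 0 <= p by apply: sumr_ge0 => j _; apply: sumr_ge0.
pose Y0 := 2 * p * (2 / k + b + 1 / k).
exists (1 + Y0); exists (Num.truncn (2 * p / k)).+1 => L L0L u a e x t xb te aL Tu i.
have L1 : 1 <= L%:R :> R by rewrite ler1n (leq_trans _ L0L).
have t0 : 0 < t by rewrite mulr_gt0 // (lt_le_trans _ L1).
(* The threshold on [L] makes [p * Y] at most half of [t * Y], so that the self-referential bound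
   [tY] below can be solved for [Y]. *)
have tp : 2 * p <= t.
  rewrite /t (mulrC k) -ler_pdivrMr //; apply: ltW.
  by apply: (lt_le_trans (truncnS_gt _)); rewrite ler_nat; exact: ltnW.
pose Y : R := \sum_j `|(u j 0)%:~R|.
have Y_ge0 : 0 <= Y by apply: sumr_ge0.
(* The error from rounding the matrix, at most [Y] because each entry moves by less than 1. *)
pose F i := \sum_j (t * B i j - (floor_mx t B i j)%:~R) * (u j 0)%:~R.
have FY l : `|F l| <= Y.
  apply: (le_trans (ler_norm_sum _ _ _)); apply: ler_sum => j _.
  rewrite normrM ler_piMl // mxE.
  have /andP[] := floor_itv (t * B l j); rewrite rmorphD /= => ? ?.
  by rewrite ger0_norm; lra.
have TuE l : \sum_j (floor_mx t B l j)%:~R * (u j 0)%:~R = (a l 0)%:~R + (e l 0)%:~R :> R.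
  rewrite -rmorphD /=; have := congr1 (fun A : 'cV_d => (A l 0)%:~R : R) Tu.
  by rewrite !mxE rmorph_sum /= => <-; apply: eq_bigr => j _; rewrite intrM.
have BuE l : t * \sum_j B l j * (u j 0)%:~R = (a l 0)%:~R + (e l 0)%:~R + F l.
  rewrite -TuE /F -big_split mulr_sumr /=; apply: eq_bigr => j _; ring.
have aeb l : `|(a l 0)%:~R + (e l 0)%:~R| <= 2 * L%:R + t * b + 1 :> R.
  have h1 : `|(a l 0)%:~R| <= 2 * L%:R :> R.
    by have := aL l; rewrite -(ler_int R) intr_norm -pmulrn natrM.
  have h2 : `|(e l 0)%:~R| <= t * b + 1 :> R.
    have := te l; have : `|t * x l 0| <= t * b by rewrite normrM gtr0_norm // ler_pM2l.
    rewrite !ler_norml => /andP[? ?] /andP[? ?]; apply/andP; split; lra.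
  by apply: (le_trans (ler_normD _ _)); lra.
(* Apply [B^-1] to [BuE] and sum absolute values; [Y] reappears on the right through [F]. *)
have tY : t * Y <= p * (2 * L%:R + t * b + 1 + Y).
  rewrite /Y mulr_sumr /p mulr_suml; apply: ler_sum => j _.
  have uE : t * (u j 0)%:~R = \sum_l P j l * (t * \sum_m B l m * (u m 0)%:~R).
    have := mulKmx (_ : B \in unitmx) (map_mx intr u : 'cV[R]_d).
    rewrite unitmxE unitfE => /(_ dB) /(congr1 (fun A : 'cV_d => A j 0)).
    rewrite !mxE => <-; rewrite mulr_sumr; apply: eq_bigr => l _.
    rewrite mulrCA; congr (_ * (_ * _)); rewrite mxE; apply: eq_bigr => m _; rewrite !mxE //.
  rewrite -[t in t * _]gtr0_norm // -normrM uE mulr_suml.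
  apply: (le_trans (ler_norm_sum _ _ _)); apply: ler_sum => l _.
  rewrite normrM ler_wpM2l // BuE; apply: (le_trans (ler_normD _ _)).
  exact: lerD.
have YY0 : Y <= Y0.
  rewrite -(ler_pM2l t0) /Y0.
  have -> : t * (2 * p * (2 / k + b + 1 / k)) = 2 * p * (2 * L%:R + t * b + L%:R).
    by rewrite /t; field; rewrite lt0r_neq0.
  have : 2 * p * Y <= t * Y by rewrite ler_wpM2r.
  have : p * (2 * L%:R + t * b + 1) <= p * (2 * L%:R + t * b + L%:R).
    by rewrite ler_wpM2l //; lra.
  lra.
rewrite mulrBr BuE.
have -> : t * x i 0 - ((a i 0)%:~R + (e i 0)%:~R + F i) + (a i 0)%:~R =
  (t * x i 0 - (e i 0)%:~R) - F i by ring.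
apply: (le_trans (ler_normB _ _)).
by have := te i; have := FY i; lra.
Qed.

(** * The discretised polydisc *)

Section BallFamily.
Variables (d L : nat) (c : 'I_d -> 'I_d).
Hypothesis cK : involutive c.
Local Notation I := 'I_(2 * L).+1.

(* A point is stored at the fixed points of [c] and, for a pair of conjugate
   indices, at the smaller one; the unused entries are [ord0]. *)
Definition ball_fiber (i : 'I_d) : {set I * I} :=
  if c i == i then [set (a, ord0) | a in [set: I]]%SET
  else if (i < c i)%N then int_disc L else [set (ord0, ord0)]%SET.

Definition ball_family : {set {ffun 'I_d -> I * I}} :=
  [set g in family (fun i => mem (ball_fiber i))]%SET.

Lemma card_ball_family : #|ball_family| =
  ((2 * L).+1 ^ #|[pred i | c i == i]| *
   #|int_disc L| ^ #|[pred i : 'I_d | (i < c i)%N]|)%N.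
Proof.
rewrite cardsE card_family foldrE big_map big_enum /=.
rewrite (big_involution _ _ cK) /= -!prod_nat_const; congr (_ * _)%N.
  apply: eq_bigr => i /eqP ci; rewrite /ball_fiber ci eqxx card_imset ?cardsT ?card_ord //.
  by move=> a b [].
apply: eq_bigr => i ic; rewrite /ball_fiber cK ic ltnNge (ltnW ic) /=.
by rewrite [i == c i]eq_sym -(inj_eq val_inj) /= gtn_eqF // cards1 muln1.
Qed.

(** Same layout as [emb_coord]: the first coordinate of a disc point goes to the smaller index of
    the pair, the second to the larger. *)
Definition ball_vec (g : {ffun 'I_d -> I * I}) : 'cV[int]_d :=
  \col_i if (i <= c i)%N then centered (g i).1 else centered (g (c i)).2.

(** The entries that [ball_vec] does not read are pinned to [ord0] by the fibers, so nothing is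
    lost. *)
Lemma ball_vec_inj : {in ball_family &, injective ball_vec}.
Proof.
move=> g g'; rewrite !finset.inE => /familyP gF /familyP g'F gg'.
have E i := congr1 (fun A : 'cV_d => A i 0) gg'.
apply/ffunP => i; have := gF i; have := g'F i; have := E i; have := E (c i).
rewrite !mxE cK /ball_fiber; case: eqVneq => [->|ci].
  rewrite leqnn => _ /centered_inj h /imsetP[a _ aE] /imsetP[b _ bE].
  by move: h; rewrite aE bE => /= ->.
case: ltnP => ic.
  rewrite (ltnW ic) /= => /centered_inj h2 /centered_inj h1 _ _.
  by case: (g i) (g' i) h1 h2 => [a b] [a' b'] /= -> ->.
by move=> _ _ /set1P -> /set1P ->.
Qed.

Lemma ball_vec_le g i : `|ball_vec g i 0| <= L%:Z.
Proof. by rewrite mxE; case: ifP => _; exact: centered_le. Qed.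

Lemma ball_vec_sub_le g g' i : `|(ball_vec g - ball_vec g') i 0| <= (2 * L)%:Z.
Proof. by have := ball_vec_le g i; have := ball_vec_le g' i; rewrite !mxE; lia. Qed.

Lemma ball_vec_disc g (i : 'I_d) : g \in ball_family -> (i < c i)%N ->
  ball_vec g i 0 ^+ 2 + ball_vec g (c i) 0 ^+ 2 <= L%:Z ^+ 2.
Proof.
rewrite finset.inE => /familyP /(_ i) + ic; rewrite /ball_fiber ic.
rewrite -(inj_eq val_inj) /= gtn_eqF // finset.inE.
by rewrite !mxE cK (ltnW ic) leqNgt ic.
Qed.

End BallFamily.

(** * The approximation theorem *)

(** Continuity at 2. The room gained by [k > 2] is what makes [2 / k], and later [e], less than
    1. *)
Lemma exists_expr_lt (R : realType) (d : nat) (X Y : R) : 2 ^+ d * X < Y ->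
  exists2 k : R, 2 < k & k ^+ d * X < Y.
Proof.
move=> XY; have kcvg : (2 + l.+1%:R^-1 : R) ^+ d * X @[l --> \oo] --> 2 ^+ d * X.
  apply: cvgM; last exact: cvg_cst.
  apply: cvg_exprn; rewrite -[X in _ --> X]addr0.
  by apply: cvgD; [exact: cvg_cst|exact: cvg_harmonic].
have [N _ /(_ N (leqnn N)) /= NP] := cvgr_lt _ kcvg _ XY.
by exists (2 + N.+1%:R^-1); rewrite // ltrDl invr_gt0.
Qed.

Lemma normc_le (R : realType) (x y : R) : `|x +i* y| <= (`|x| + `|y|)%:C.
Proof.
rewrite normc_def lecR /= -[leRHS]ger0_norm ?addr_ge0 // -sqrtr_sqr ler_wsqrtr //.
rewrite sqrrD !real_normK ?num_real // -addrA [_ *+ 2 + _]addrC addrA lerDl.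
by rewrite mulrn_wge0 // mulr_ge0.
Qed.

Section Approximation.
Variables (R : realType) (K : fieldExtType rat).
Local Notation C := R[i].
Local Notation d := (\dim {:K}).
Variable s : 'I_d -> {rmorphism K -> C}.
Hypothesis s_free : (\matrix_(i, k) s i (vbasis {:K})`_k) \in unitmx.
Hypothesis s_all : forall f : {rmorphism K -> C}, exists i, f =1 s i.
Variable c : 'I_d -> 'I_d.
Hypothesis cK : involutive c.
Hypothesis sc : forall i x, s (c i) x = conjc (s i x).
Local Notation coo := (emb_coord s c).

Lemma emb_coordD i x y : coo i (x + y) = coo i x + coo i y.
Proof. by rewrite /emb_coord rmorphD; case: (s i x) (s i y) => a b [a' b'] /=; case: ifP. Qed.

Lemma emb_coordZ i (q : rat) x : coo i (q *: x) = ratr q * coo i x.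
Proof.
rewrite /emb_coord rmorphZ_num -real_complex_ratr; case: (s i x) => a b /=.
by case: ifP => _; ring.
Qed.

Lemma emb_coord_sum i (I : finType) (f : I -> K) : coo i (\sum_k f k) = \sum_k coo i (f k).
Proof.
apply: (big_morph (coo i) (emb_coordD i)).
by rewrite -[0 in LHS](scale0r 0) emb_coordZ rmorph0 mul0r.
Qed.

Lemma emb_coordB i x y : coo i (x - y) = coo i x - coo i y.
Proof. by rewrite -scaleN1r emb_coordD emb_coordZ rmorphN1 mulN1r. Qed.

(** [t * s i x] is a lattice point of modulus at most [r], up to sign, plus an error of at most [e]
    per real coordinate. Conjugation reduces to the smaller index of a pair. *)
Lemma emb_norm_le (t r e : R) (a : 'cV[int]_d) (x : K) : 0 < t ->
  (forall i, `|(a i 0)%:~R| <= r) ->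
  (forall i : 'I_d, (i < c i)%N -> `|(a i 0)%:~R -i* (a (c i) 0)%:~R| <= r%:C) ->
  (forall i, `|t * coo i x + (a i 0)%:~R| <= e) ->
  forall i, `|s i x| <= ((r + 2 * e) / t)%:C.
Proof.
move=> t0 ar apos ae.
suff h (i : 'I_d) : (i <= c i)%N -> `|s i x| <= ((r + 2 * e) / t)%:C.
  move=> i; case: (leqP i (c i)) => [/h //|ic].
  by rewrite -(cK i) sc normcJ; apply: h; rewrite cK ltnW.
move=> ic; have e0 : 0 <= e := le_trans (normr_ge0 _) (ae i).
suff h : `|t%:C * s i x| <= (r + 2 * e)%:C.
  move: h; rewrite normrM ger0_norm => [h|]; last by rewrite ler0c ltW.
  by rewrite rmorphM fmorphV /= ler_pdivlMr ?ltcR // mulrC.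
have [ci|ci] := eqVneq (c i) i.
  have := sc i x; have := ae i; have := ar i; rewrite /emb_coord ci leqnn.
  case: (s i x) => u v /= h1 h2 [h3]; have -> : v = 0 by lra.
  have -> : t%:C * (u +i* 0) = (t * u)%:C by rewrite rmorphM.
  rewrite normc_def lecR /= expr0n addr0 sqrtr_sqr.
  move: h1 h2; rewrite !ler_norml => /andP[? ?] /andP[? ?].
  by apply/andP; split; lra.
have {}ic : (i < c i)%N by rewrite ltn_neqAle ic andbT eq_sym.
(* The coordinate at [c i] is the imaginary part of the conjugate, hence the minus signs in
   [-i*]. *)
have -> : t%:C * s i x = ((t * coo i x + (a i 0)%:~R) -i* (t * coo (c i) x + (a (c i) 0)%:~R))
    - ((a i 0)%:~R -i* (a (c i) 0)%:~R).
  rewrite /emb_coord cK (ltnW ic) leqNgt ic sc; case: (s i x) => u v /=.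
  by apply/eqP; rewrite eq_complex /=; apply/andP; split; apply/eqP; ring.
apply: (le_trans (ler_normB _ _)); rewrite addrC rmorphD; apply: lerD; first exact: apos.
apply: (le_trans (normc_le _ _)); rewrite lecR normrN.
by have := ae i; have := ae (c i); lra.
Qed.

Lemma ball_vec_sub_norm L g g' (i : 'I_d) :
  g \in ball_family L c -> g' \in ball_family L c -> (i < c i)%N ->
  `|(ball_vec c g i 0 - ball_vec c g' i 0)%:~R
    -i* (ball_vec c g (c i) 0 - ball_vec c g' (c i) 0)%:~R| <= (2 * L%:R)%:C :> C.
Proof.
move=> gF g'F ic.
have h f : f \in ball_family L c ->
    `|(ball_vec c f i 0)%:~R -i* (ball_vec c f (c i) 0)%:~R| <= L%:R%:C :> C.
  move=> fF; rewrite normc_def lecR /= sqrrN -[leRHS]ger0_norm // -sqrtr_sqr ler_wsqrtr //.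
  by have := ball_vec_disc cK fF ic; rewrite -(ler_int R) rmorphD !rmorphXn /= -pmulrn.
have -> : (ball_vec c g i 0 - ball_vec c g' i 0)%:~R
    -i* (ball_vec c g (c i) 0 - ball_vec c g' (c i) 0)%:~R =
  ((ball_vec c g i 0)%:~R -i* (ball_vec c g (c i) 0)%:~R)
  - ((ball_vec c g' i 0)%:~R -i* (ball_vec c g' (c i) 0)%:~R) :> C.
  by apply/eqP; rewrite eq_complex /= !rmorphB /=; apply/andP; split; apply/eqP; ring.
apply: (le_trans (ler_normB _ _)).
have -> : (2 * L%:R)%:C = L%:R%:C + L%:R%:C :> C by rewrite -rmorphD; congr _%:C; ring.
by apply: lerD; exact: h.
Qed.

Variable A : set K.
Hypothesis A_ideal : integral_ideal A.
Hypothesis A_neq0 : exists2 a, A a & a != 0.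
Local Notation w := (integral_basis K).

(** Each pair [(j, g)] receives a class modulo [T] and a class modulo [A]. The second label records
    the lattice translation used to reach the representative of the first, so agreement of both puts
    the total translation in [A]. *)
Lemma lattice_collision (L M : nat) (T : 'M[int]_d) (V : 'I_M -> 'cV[int]_d) (o : 'I_M -> K) :
  \det T != 0 -> (`|\det T| * ideal_norm A < M * #|ball_family L c|)%N ->
  (forall j, ring_of_integers (o j)) ->
  exists j j' g g' u, [/\ (j, g) != (j', g'), g \in ball_family L c, g' \in ball_family L c,
    T *m u = (ball_vec c g - ball_vec c g') + (V j - V j') &
    A (o j - o j' + \sum_(k < d) w`_k *~ u k 0)].
Proof.
move=> T0 count oO.
have [cls clsP] := int_mx_classes T0.
have [kap kapP] := ideal_norm_classes s_free A_ideal A_neq0.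
have [_ OE] := integral_basisP s_free.
(* One representative per class modulo [T], with 0 as a dummy for empty classes; [U z] is then the
   translation from it to [z]. *)
have repE k : exists r, forall z, cls z = k -> exists u, z - r = T *m u.
  have [[z0 <-]|h] := pselect (exists z0, cls z0 = k).
    by exists z0 => z /clsP.
  by exists 0 => z zk; case: h; exists z.
have [rep repP] := choice repE.
have [U UP] := choice (fun z => repP _ z erefl).
pose z (p : 'I_M * {ffun 'I_d -> 'I_(2 * L).+1 * 'I_(2 * L).+1}) := ball_vec c p.2 + V p.1.
pose y p := o p.1 + \sum_(k < d) w`_k *~ U (z p) k 0.
have yO p : ring_of_integers (y p).
  have h : ring_of_integers (\sum_(k < d) w`_k *~ U (z p) k 0).
    by rewrite OE; exists (fun k => U (z p) k 0).
  exact: integral_add (oO _) h.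
have [|[j g] [[j' g'] []]] := @pigeonhole_in _ _ (fun p => (cls (z p), kap (y p)))
    (finset.setX [set: 'I_M]%SET (ball_family L c)).
  by rewrite card_prod !card_ord cardsX cardsT card_ord.
rewrite !finset.in_setX => /andP[_ gF] /andP[_ g'F] neq [clsE kapE].
exists j, j', g, g', (U (z (j, g)) - U (z (j', g'))); split => //.
  rewrite mulmxBr -!UP clsE /z /=; rewrite opprB addrA subrK.
  by rewrite opprD addrACA.
have := kapP _ _ (yO (j, g)) (yO (j', g')) kapE; rewrite /y /=.
rewrite opprD addrACA -sumrB; congr (A (_ + _)).
by apply: eq_bigr => k _; rewrite !mxE mulrzBr.
Qed.


Lemma trace_disc_integral_basis_neq0 : trace_disc (fun k : 'I_d => w`_k) != 0.
Proof.
have [wB _] := integral_basisP s_free.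
have := trace_disc_vbasis_neq0 s_free.
rewrite (trace_disc_mulmx s_free (w := fun k : 'I_d => w`_k)
  (Q := \matrix_(j, k) coord w j (vbasis {:K})`_k)) => [|k].
  by rewrite mulf_eq0 negb_or => /andP[].
rewrite {1}(coord_basis wB (memvf (vbasis {:K})`_k)).
by apply: eq_bigr => j _; rewrite mxE.
Qed.

Lemma coord_mx_integral_basis : [/\ \det (coord_mx s c (fun k => w`_k)) != 0 &
  Num.sqrt `|ratr (discriminant K)| =
    2 ^+ r2 K R * `|\det (coord_mx s c (fun k => w`_k))|].
Proof.
have sq := sqrt_trace_disc s_free s_all cK sc (fun k => w`_k); split; last exact: sq.
rewrite -normr_eq0; apply/negP => /eqP d0; move: sq; rewrite d0 mulr0 => /eqP.
rewrite sqrtr_eq0 normr_le0 fmorph_eq0; apply/negP.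
exact: trace_disc_integral_basis_neq0.
Qed.

(** Multiply the hypothesis by [2 ^ r1 * pi ^ r2], the volume of the unit polydisc, and use
    [r1 + 2 r2 = d]; the factor [2 ^+ d] stands for radius 1/2. *)
Lemma covolume_lt (M : R) : c_const R A < M ->
  2 ^+ d * (`|\det (coord_mx s c (fun k => w`_k))| * (ideal_norm A)%:R) <
  M * (2 ^+ #|[pred i | c i == i]| * pi ^+ #|[pred i : 'I_d | (i < c i)%N]|).
Proof.
have [_ sq] := coord_mx_integral_basis.
rewrite /c_const gt_max sq => /andP[+ _].
rewrite (r2E s_free s_all cK sc); set p := #|[pred i : 'I_d | (i < c i)%N]|.
set q := #|_|.
have dE : (q + (p + p) = d)%N by rewrite addnn -mul2n card_involution.
have pi0 : 0 < (pi : R) ^+ p by rewrite exprn_gt0 // pi_gt0.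
rewrite -(ltr_pM2r pi0) expr_div_n -(ltr_pM2l (exprn_gt0 q (ltr0Sn R 1))).
have -> : 2 ^+ d = 2 ^+ q * (2 ^+ p * 2 ^+ p) :> R by rewrite -dE !exprD.
set x := 2 ^+ p; set z := 2 ^+ q; set b := `|_|; set n := _%:R.
set y := pi ^+ p => h.
have -> : z * (x * x) * (b * n) = z * (x / y * (x * b) * n * y).
  by field; rewrite lt0r_neq0.
by apply: (lt_le_trans h); rewrite le_eqVlt; apply/orP; left; apply/eqP; ring.
Qed.

Lemma emb_coord_basis_sum i (q : 'I_d -> rat) :
  coo i (\sum_k q k *: w`_k) = \sum_k coord_mx s c (fun k => w`_k) i k * ratr (q k).
Proof.
rewrite emb_coord_sum; apply: eq_bigr => k _.
by rewrite emb_coordZ mxE mulrC.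
Qed.

Lemma approximation (M : nat) : c_const R A < M%:R ->
  exists2 e : R, 0 < e < 1 & forall xi : K, exists tau : K, exists j : int,
    [/\ A tau, 0 < j < M%:Z & forall i, `|s i (j%:~R * xi - tau)| < e%:C].
Proof.
move=> cM; have [B0 _] := coord_mx_integral_basis.
have [wB OE] := integral_basisP s_free.
have [_ A0 _ _] := A_ideal; have [Asub _ _ _] := A_ideal.
have [k k2 kM] := exists_expr_lt (covolume_lt cM); rewrite [X in X < _]mulrA in kM.
have k0 : 0 < k := lt_trans (ltr0Sn R 1) k2.
set B := coord_mx s c _ in B0 kM.
pose b := \sum_i \sum_j `|B i j|.
have b0 : 0 <= b by apply: sumr_ge0 => i _; apply: sumr_ge0.
have bB i : \sum_j `|B i j| <= b.
  by rewrite /b [leRHS](bigD1 i) //= lerDl; apply: sumr_ge0 => l _; apply: sumr_ge0.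
have dE := card_involution cK.
have [Er [L0 pert]] := floor_mx_perturbation k0 b0 B0.
have [L1 asym] := det_floor_mx_asymptotics dE k0 B0 kM.
clear kM cM.
have k21 : 2 / k < 1 by rewrite ltr_pdivrMr // mul1r.
(* The midpoint of [2 / k] and 1 leaves a margin [e - 2 / k] to absorb rounding. Neither [e] nor [L]
   depends on [xi], which is introduced only after both are fixed. *)
pose e := (2 / k + 1) / 2.
have ke : 2 / k < e by rewrite /e; lra.
have e1 : e < 1 by rewrite /e; lra.
have e0 : 0 < e by apply: lt_trans ke; rewrite divr_gt0.
exists e; first by rewrite e0 e1.
(* Beyond both thresholds, and large enough that the error [2 * Er / (k * L)] fits in the margin. *)
pose L := (maxn L0 (maxn L1 (Num.truncn (2 * `|Er| / (k * (e - 2 / k)))))).+1.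
have [LL0 LL1 LE] : [/\ (L0 < L)%N, (L1 < L)%N &
    (Num.truncn (2 * `|Er| / (k * (e - 2 / k))) < L)%N].
  by rewrite /L !ltnS !leq_max !leqnn !orbT; split.
have L_gt0 : 0 < L%:R :> R by rewrite ltr0n.
pose t := k * L%:R; have t0 : 0 < t by rewrite mulr_gt0.
have hL : (2 * L%:R + 2 * Er) / t < e.
  have : 2 * `|Er| / (k * (e - 2 / k)) < L%:R.
    by apply: (lt_le_trans (truncnS_gt _)); rewrite ler_nat.
  rewrite ltr_pdivrMr ?mulr_gt0 ?subr_gt0 // ltr_pdivrMr //.
  have -> : L%:R * (k * (e - 2 / k)) = e * t - 2 * L%:R.
    by rewrite /t; field; rewrite lt0r_neq0.
  by have := ler_norm Er; lra.
have [T0 count] := asym L LL1; rewrite -card_ball_family // in count.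
move=> xi.
pose q (j : 'I_M) (l : 'I_d) := coord w l (j%:R * xi).
pose o (j : 'I_M) : K := \sum_(l < d) w`_l *~ Num.floor (q j l).
(* Keeping fractional parts moves [j * xi] into the fundamental parallelotope of the integral basis,
   which bounds its coordinates by [b] uniformly in [xi]. *)
pose f (j : 'I_M) l := q j l - (Num.floor (q j l))%:~R.
pose y (j : 'I_M) := j%:R * xi - o j.
have yE j : y j = \sum_l f j l *: w`_l.
  rewrite /y /o {1}(coord_basis wB (memvf (j%:R * xi))) -sumrB.
  by apply: eq_bigr => l _; rewrite scalerBl scaler_int.
have oO j : ring_of_integers (o j).
  by rewrite OE; exists (fun l => Num.floor (q j l)).
pose V (j : 'I_M) : 'cV[int]_d := \col_i Num.floor (t * coo i (y j)).
have [j [j' [g [g' [u [neq gF g'F Tu Atau]]]]]] := lattice_collision V T0 count oO.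
set tau := (X in A X) in Atau.
pose x : 'cV[R]_d := \col_i (coo i (y j) - coo i (y j')).
have xE i : x i 0 = coo i (y j) - coo i (y j') by rewrite mxE.
have xb i : `|x i 0| <= b.
  rewrite xE !yE !emb_coord_basis_sum -sumrB; apply: le_trans (bB i).
  apply: (le_trans (ler_norm_sum _ _ _)); apply: ler_sum => l _.
  rewrite -mulrBr normrM ler_piMr // -rmorphB -ratr_norm.
  by rewrite -(rmorph1 (ratr : rat -> R)) ler_rat dist_frac_le1.
have xV i : `|t * x i 0 - ((V j - V j') i 0)%:~R| <= 1.
  rewrite xE !mxE rmorphB /=.
  apply: le_trans (dist_frac_le1 (t * coo i (y j)) (t * coo i (y j'))).
  by rewrite le_eqVlt; apply/orP; left; apply/eqP; congr (`|_|); ring.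
have aL := ball_vec_sub_le c g g'.
have bound := pert L LL0 u _ _ x xb xV aL Tu.
have deltaE : y j - y j' - \sum_(l < d) w`_l *~ u l 0 = (j%:R - j'%:R) * xi - tau.
  by rewrite /y /tau mulrBl !opprD !opprK; ring.
have coo_delta i : coo i ((j%:R - j'%:R) * xi - tau) =
    x i 0 - \sum_l B i l * (u l 0)%:~R.
  rewrite -deltaE emb_coordB emb_coordB xE; congr (_ - _).
  under eq_bigr do rewrite -scaler_int.
  by rewrite emb_coord_basis_sum; apply: eq_bigr => l _; rewrite ratr_int.
have small i : `|s i ((j%:R - j'%:R) * xi - tau)| < e%:C.
  apply: (@le_lt_trans _ _ ((2 * L%:R + 2 * Er) / t)%:C); last by rewrite ltcR.
  apply: (emb_norm_le (a := ball_vec c g - ball_vec c g') t0) => l.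
  - by have := aL l; rewrite -(ler_int R) intr_norm -pmulrn natrM.
  - by move=> lc; have := ball_vec_sub_norm gF g'F lc; rewrite !mxE.
  by rewrite coo_delta.
have tauN := idealN A_ideal Atau.
have sgn (a a' : 'I_M) : (a%:Z - a'%:Z)%:~R = a%:R - a'%:R :> K by rewrite rmorphB.
(* For [j < j'] both the multiplier and [tau] change sign, which keeps the multiplier positive. *)
have [jj'|j'j|jj'] := ltngtP j j'.
- exists (- tau), (j'%:Z - j%:Z); split; [exact: tauN|exact: ord_sub_itv|].
  move=> i; rewrite sgn (_ : _ - _ = - ((j%:R - j'%:R) * xi - tau)); last by ring.
  by rewrite rmorphN normrN.
- exists tau, (j%:Z - j'%:Z); split; [exact: Atau|exact: ord_sub_itv|].
  by move=> i; rewrite sgn.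
have {}jj' : j = j' := val_inj jj'.
case/negP: neq; rewrite -jj'; apply/eqP; congr (_, _).
(* With equal multipliers, all conjugates of [tau] are less than [e < 1], so a nonzero [tau] in [A]
   would have norm less than 1. Then [u = 0], hence [g = g'], against [neq]. *)
have tau0 : tau = 0.
  apply/eqP/negPn/negP => tau0.
  have := field_norm_ge1 s_free (Asub _ Atau) tau0; apply/negP; rewrite -ltNge.
  have lt i : `|s i tau| < e%:C.
    by have := small i; rewrite jj' subrr mul0r sub0r rmorphN normrN.
  have := field_norm_lt s_free lt; rewrite -(ltr_rat R) rmorph1 => /lt_trans; apply.
  by rewrite exprn_ilt1 ?ltW // -lt0n; exact: (adim_gt0 (aspacef K)).
have u0 l : u l 0 = 0.
  move: tau0; rewrite /tau jj' subrr add0r => h.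
  have /freeP /(_ (fun l => (u l 0)%:~R)) := basis_free wB.
  under eq_bigr do rewrite scaler_int.
  by move=> /(_ h l) /eqP; rewrite intr_eq0 => /eqP.
apply: (ball_vec_inj cK) => //; apply/eqP; rewrite -subr_eq0; apply/eqP.
have := Tu; rewrite jj' subrr addr0 => <-.
apply/colP => l; rewrite !mxE big1 // => m _; rewrite u0 mulr0 //.
Qed.

End Approximation.

Theorem theorem5p6 (R : realType) (K : fieldExtType rat) (A : set K) :
  integral_ideal A -> (exists2 a, A a & a != 0) ->
  forall M : int, c_const R A < M%:~R ->
  exists2 e : R, 0 < e < 1 &
    forall xi : K, exists tau : K, exists j : int,
      [/\ A tau, 0 < j < M,
          forall sigma : {rmorphism K -> R[i]},
            `|sigma (j%:~R * xi - tau)| < e%:C &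
          ratr `|field_norm (j%:~R * xi - tau)| < e ^+ \dim {:K}].
Proof.
move=> A_ideal A_neq0 M cM.
have [s [s_all s_free]] := exists_embeddings R K.
have [c [cK sc]] := exists_emb_conj s_free s_all.
(* The maximum with 1 in [c_const] forces [M] to be positive, so it can be treated as a natural
   number. *)
have M0 : 0 <= M.
  rewrite -(ler0z R) (le_trans _ (ltW cM)) // /c_const le_max ler01 orbT //.
case: M M0 cM => // M _ cM.
have [e e01 eP] := approximation s_free s_all cK sc A_ideal A_neq0 cM.
exists e => // xi; have [tau [j [Atau j0M small]]] := eP xi.
exists tau, j; split => // [sigma|]; last exact (field_norm_lt s_free small).
by have [i ->] := s_all sigma.
Qed.
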